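(* Let $\varphi:\Gamma\to\mathbb{R}^2$ be a parametrised tropical curve of genus $2$. If $(\Gamma,\varphi)$ is superabundant then either: (i) $(\Gamma,\varphi)$ is planar superabundant, i.e. a cycle of $\Gamma$ is mapped by $\varphi$ into an affine line in $\mathbb{R}^2$; or (ii) $(\Gamma,\varphi)$ may be transformed, by a rational transformation of $\mathbb{R}^2$ followed by a rational dilation, into a parametrised tropical curve $(\Gamma',\varphi')$ which has three segments contained in the lines $\{x=0\}$, $\{y=0\}$ and $\{x=y\}$ respectively. Conversely, any parametrised tropical curve of genus $2$ in $\mathbb{R}^2$ satisfying one of the two conditions (i), (ii) is superabundant.
   Context: An abstract tropical curve $\Gamma=(G,m,\ell)$ consists of a finite graph $G$, a marking function $m:\{1,\dots,n\}\to V(G)$ and a length function $\ell:E(G)\to\mathbb{R}_{>0}$. It is regarded as a metric space: each edge $e$ is a segment of length $\ell(e)$, and for each $i$ a half-line $\mathbb{R}_{\ge0}$ (a leg) is glued at $0$ to $m(i)$. The genus is the first Betti number of $G$. A parametrised tropical curve is a pair $(\Gamma,\varphi)$ with $\varphi:\Gamma\to\mathbb{R}^r$ continuous, affine linear with integer slope on each edge and leg, and balanced: at every point of $\Gamma$ the sum of the outgoing directional derivatives of $\varphi$ is $0$. Superabundancy. Let $(\Gamma,\varphi)$ have genus $g$ and $b$ bounded edges, in $\mathbb{R}^r$; orient the edges and let $w_e\in\mathbb{Z}^r$ be the slope along $e$. The deformation space modulo translations is the cone of $(\ell_e)\in\mathbb{R}_{>0}^{E(G)}$ with $\sum_e a_e\ell_e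 w_e=0$ for every cycle $\sum_e a_e[e]\in H_1(G,\mathbb{Z})$. $(\Gamma,\varphi)$ is superabundant if the dimension of this cone is greater than $b-rg$. Segments. The smoothing of $G$ is obtained by deleting all edges (and legs) not contained in any cycle, deleting vertices that then have valence $0$, passing to the underlying topological space, and giving it its minimal graph structure. A segment of $\Gamma$ is the set of edges of $G$ lying over a single edge of the smoothing; it is said to be contained in a set if its image under $\varphi$ is. A rational dilation of $\Gamma$ multiplies the lengths of edges (and rescales legs) by positive rational numbers. A rational transformation of $\mathbb{R}^2$ is a map $x\mapsto Qx+b$ with $Q\in GL_2(\mathbb{Q})$ and $b\in\mathbb{R}^2$; composing $\varphi$ with it and applying a suitable rational dilation to $\Gamma$ to restore integral slopes gives a new parametrised tropical curve. *)

(* Defs.v *)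
From HB Require Import structures.
From mathcomp Require Import all_boot all_order all_algebra.
From mathcomp Require Import boolp classical_sets reals.

Set Implicit Arguments.
Unset Strict Implicit.
Unset Printing Implicit Defensive.

Import Order.TTheory GRing.Theory Num.Theory.
Local Open Scope ring_scope.
Local Open Scope classical_set_scope.

(* Loops and parallel edges are allowed. The orientation given by [src] and
   [tgt] is an auxiliary choice. *)
Record graph := Graph {
  vert : finType;
  edge : finType;
  src : edge -> vert;
  tgt : edge -> vert }.

Section Homology.
Variables (G : graph) (A : nzRingType).

Definition boundary (a : {ffun edge G -> A^o}) : {ffun vert G -> A^o} :=
  [ffun v => \sum_(e | tgt e == v) a e - \sum_(e | src e == v) a e].

Fact boundary_is_linear : linear boundary.
Proof.
move=> k a b; apply/ffunP=> v; rewrite !ffunE scalerBr !scaler_sumr addrACA.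
rewrite -opprD -!big_split /=.
by congr (_ - _); apply: eq_bigr => e _; rewrite !ffunE.
Qed.

HB.instance Definition _ :=
  GRing.isLinear.Build A {ffun edge G -> A^o} {ffun vert G -> A^o} *:%R
    boundary boundary_is_linear.

End Homology.

(* dim_Q H_1(G; Q), which is the rank of H_1(G; Z). *)
Definition genus (G : graph) : nat := \dim (lker (linfun (@boundary G rat))).

Section Subgraphs.
Variable G : graph.
Implicit Types (C S : {set edge G}) (W : {set vert G}) (v : vert G)
  (e f : edge G).

Definition incident v e : bool := (src e == v) || (tgt e == v).

(* A loop counts twice. *)
Definition valence C v : nat :=
  (#|[set e in C | src e == v]| + #|[set e in C | tgt e == v]|)%N.

Definition joined C W : rel (edge G) := fun e f =>
  [&& e \in C, f \in C & [exists v in W, incident v e && incident v f]].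

(* A cycle is identified with its edge set: a nonempty connected subgraph all
   of whose vertices have valence 2. *)
Definition is_cycle C : bool :=
  [&& C != finset.set0,
      [forall v, (valence C v == 0%N) || (valence C v == 2%N)]
    & [forall e in C, forall f in C, connect (joined C [set: vert G]%SET) e f]].

Definition cyclic_edges : {set edge G} :=
  [set e | [exists C, is_cycle C && (e \in C)]]%SET.

(* The minimal graph structure on the space underlying the subgraph
   [cyclic_edges] is obtained by forgetting the vertices of valence 2 (on a
   component homeomorphic to a circle, all of them but one, which still leaves
   a single edge). Thus two edges lie over the same edge of the smoothing iff
   they are linked by a chain of edges in which consecutive ones meet at a
   vertex of valence 2. *)
Definition segments : {set {set edge G}} :=
  equivalence_partition
    (connect (joined cyclic_edges [set v | valence cyclic_edges v == 2%N]%SET))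
    cyclic_edges.

End Subgraphs.

Record tcurve (R : realType) (n : nat) (G : graph) := TCurve {
  mark : 'I_n -> vert G;
  len : edge G -> R;
  len_gt0 : forall e, 0 < len e }.

(* The points of the metric space of a curve on G are the p : curve_point R n G
   satisfying [in_curve] below; [EdgePt e t] is the point of e at distance t
   from [src e], and [EdgePt e 0], [EdgePt e (len e)], [LegPt i 0] are to be
   identified with the corresponding vertices (see [param_map]). *)
Variant curve_point (R : realType) (n : nat) (G : graph) :=
  | VertexPt of vert G
  | EdgePt of edge G & R
  | LegPt of 'I_n & R.

Arguments VertexPt {R n G}.
Arguments EdgePt {R n G}.
Arguments LegPt {R n G}.

Definition in_curve (R : realType) (n : nat) (G : graph) (Gam : tcurve R n G)
    (p : curve_point R n G) : bool :=
  match p with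
  | VertexPt _ => true
  | EdgePt e t => 0 <= t <= len Gam e
  | LegPt _ t => 0 <= t
  end.

Definition points_over (R : realType) (n : nat) (G : graph)
    (Gam : tcurve R n G) (S : {set edge G}) : set (curve_point R n G) :=
  [set p | exists e t, [/\ e \in S, 0 <= t <= len Gam e & p = EdgePt e t]].

(* [map_src], [map_tgt] and [map_leg0] say that [map_fun] descends to the glued
   space; being affine on each edge and leg it is then continuous. Values of
   [map_fun] outside [in_curve] are irrelevant. Balancing only needs to be
   imposed at vertices: at a point inside an edge or leg the two outgoing
   derivatives are opposite. *)
Record param_map (R : realType) (n : nat) (G : graph) (Gam : tcurve R n G)
    (r : nat) := ParamMap {
  map_fun :> curve_point R n G -> 'cV[R]_r;
  slope : edge G -> 'cV[int]_r;
  leg_slope : 'I_n -> 'cV[int]_r;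
  map_src : forall e, map_fun (EdgePt e 0) = map_fun (VertexPt (src e));
  map_tgt : forall e,
    map_fun (EdgePt e (len Gam e)) = map_fun (VertexPt (tgt e));
  map_leg0 : forall i, map_fun (LegPt i 0) = map_fun (VertexPt (mark Gam i));
  map_edge : forall e t, 0 <= t <= len Gam e ->
    map_fun (EdgePt e t) = map_fun (EdgePt e 0) + t *: map_mx intr (slope e);
  map_leg : forall i t, 0 <= t ->
    map_fun (LegPt i t) = map_fun (LegPt i 0) + t *: map_mx intr (leg_slope i);
  map_balanced : forall v,
    \sum_(e | src e == v) slope e - \sum_(e | tgt e == v) slope e
      + \sum_(i | mark Gam i == v) leg_slope i = 0 }.

(* The dimension of a cone is that of its linear span. *)
Definition has_dim (K : fieldType) (U : vectType K) (C : set U) (d : nat) :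
    Prop :=
  exists X : d.-tuple U,
    [/\ free X, (forall x, x \in tval X -> C x)
      & forall y, C y -> y \in <<X>>%VS].

Section Superabundancy.
Variables (R : realType) (n : nat) (G : graph) (Gam : tcurve R n G) (r : nat).
Variable phi : param_map Gam r.

Definition deformation_cone : set {ffun edge G -> R^o} :=
  [set l | (forall e, 0 < l e) /\
    forall a : {ffun edge G -> int^o}, boundary a = 0 ->
      \sum_e ((a e)%:~R * l e) *: map_mx intr (slope phi e) = 0 :> 'cV[R]_r].

Definition superabundant : Prop :=
  exists d : nat, has_dim deformation_cone d /\
    #|edge G|%:Z - (r * genus G)%N%:Z < d%:Z.

End Superabundancy.

Definition affine_line (R : realType) (r : nat) (p v : 'cV[R]_r) :
    set 'cV[R]_r :=
  [set x | exists t : R, x = p + t *: v].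

Definition planar_superabundant (R : realType) (n : nat) (G : graph)
    (Gam : tcurve R n G) (phi : param_map Gam 2) : Prop :=
  exists C : {set edge G}, is_cycle C /\
    exists p v : 'cV[R]_2, v != 0 /\
      phi @` points_over Gam C `<=` affine_line p v.

(* Each edge and each leg may have its own factor. *)
Definition rational_dilation (R : realType) (n : nat) (G : graph)
    (c : edge G -> rat) (d : 'I_n -> rat) (Gam Gam' : tcurve R n G) : Prop :=
  [/\ forall e, 0 < c e, forall i, 0 < d i, mark Gam' =1 mark Gam
    & forall e, len Gam' e = ratr (c e) * len Gam e].

Definition dilate_point (R : realType) (n : nat) (G : graph)
    (c : edge G -> rat) (d : 'I_n -> rat) (p : curve_point R n G) :
    curve_point R n G :=
  match p with
  | VertexPt v => VertexPt v
  | EdgePt e t => EdgePt e (ratr (c e) * t)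
  | LegPt i t => LegPt i (ratr (d i) * t)
  end.

(* That the result is again a parametrised tropical curve (integral slopes,
   balancing) is part of the type of [phi']. *)
Definition transforms_to (R : realType) (n : nat) (G : graph)
    (Gam : tcurve R n G) (phi : param_map Gam 2)
    (Gam' : tcurve R n G) (phi' : param_map Gam' 2) : Prop :=
  exists (Q : 'M[rat]_2) (b : 'cV[R]_2), Q \in unitmx /\
  exists (c : edge G -> rat) (d : 'I_n -> rat),
    rational_dilation c d Gam Gam' /\
    forall p, in_curve Gam p ->
      phi' (dilate_point c d p) = map_mx ratr Q *m phi p + b.

Definition has_three_concurrent_segments (R : realType) (n : nat) (G : graph)
    (Gam : tcurve R n G) (phi : param_map Gam 2) : Prop :=
  exists S1 S2 S3 : {set edge G},
    [/\ S1 \in segments G, S2 \in segments G, S3 \in segments G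
      & uniq [:: S1; S2; S3]] /\
    [/\ phi @` points_over Gam S1 `<=` [set x : 'cV[R]_2 | x 0 0 = 0],
        phi @` points_over Gam S2 `<=` [set x : 'cV[R]_2 | x 1 0 = 0]
      & phi @` points_over Gam S3 `<=` [set x : 'cV[R]_2 | x 0 0 = x 1 0]].

(* Main.v *)
From HB Require Import structures.
Require Import Defs.
From mathcomp Require Import all_boot all_order all_algebra.
From mathcomp Require Import boolp classical_sets reals.
From mathcomp Require Import fintype finset zify ring lra.

(** Fix a basis [a1], [a2] of [H_1(G)] made of fundamental classes of cycles and
    let [u_e = (a1 e, a2 e)]. The cone of deformations is the positive part of the
    solution space of four linear equations in the edge lengths, and it contains
    the given lengths, so it has the dimension of that space. Hence the curve is superabundant iff the four
    equations are dependent, i.e. iff there is a matrix [L <> 0] with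
    [u_e L w_e = 0] on every edge, [w_e] being the slope ([superabundantP]). All
    coefficients are integers, so [L] may be chosen real or integral at will.

    If [L] is singular, [L = s^T mu], then [mu] kills the slopes on the support of
    the homology class [s_0 a1 + s_1 a2], and this support contains a cycle. If
    [L] is regular and the cycles [a1], [a2] have no common edge, the first row of
    [L] kills the slopes on [a1]. If they have a common edge, the edges lying on
    cycles fall into three classes: those of [a1] only, those of [a2] only and the common ones,
    where [a1 = eps a2] for a constant sign [eps] ([basis_sign]). On these classes
    the slopes are killed by [L_0], by [L_1] and by [eps L_0 + L_1]. The classes
    are segments with a common end ([common_vertex]), so that the coordinates
    [x = L_0], [y = - eps L_1] centred at the image of that end put them on the
    three lines. Conversely, a form [mu] killing the slopes on a cycle of class
    [s_0 a1 + s_1 a2] gives the dependency [L = s^T mu], and three segments as in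
    the second condition give one with the rows [x] and [- eps y].

    The facts about graphs are obtained by linear algebra instead of by following
    paths. A homology class of minimal support is carried by a cycle, by counting
    edges and vertices ([is_cycle_supp]), so through every edge of the support of
    a homology class there is a cycle inside this support ([cycle_through]). In
    genus 2 the segments are the classes of edges with proportional nonzero [u_e]
    ([connect_parallel]), because the complement of such a class is a cycle,
    hence connected, and on a connected subgraph every function of total zero on
    the vertices is a boundary ([fill_cycle]). *)

Set Implicit Arguments.
Unset Strict Implicit.
Unset Printing Implicit Defensive.

Import Order.TTheory GRing.Theory Num.Theory.
Local Open Scope ring_scope.

(** * Chains and valences *)

Section Chains.
Variable G : graph.
Implicit Types (C D S : {set edge G}) (W : {set vert G}) (v : vert G)
  (e f g h : edge G) (x y z : {ffun edge G -> rat^o}).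

(** The set of edges on which a chain is nonzero. *)
Definition supp x : {set edge G} := [set e | x e != 0].

(** The vertices of the subgraph with edge set [C]. *)
Definition verts C : {set vert G} := [set v | [exists e in C, incident v e]].

(** The part of the chain [x] carried by [D]. *)
Definition restr D x : {ffun edge G -> rat^o} :=
  [ffun e => if e \in D then x e else 0].

Lemma vertsP C v :
  reflect (exists2 e, e \in C & incident v e) (v \in verts C).
Proof.
by rewrite inE; apply: (iffP existsP) => [[e /andP[]]|[e]] *; exists e => //; apply/andP.
Qed.

Lemma incident_src e : incident (src e) e.
Proof. by rewrite /incident eqxx. Qed.

Lemma suppE x e : (e \in supp x) = (x e != 0).
Proof. by rewrite inE. Qed.

Lemma supp_out C x e : supp x \subset C -> e \notin C -> x e = 0.
Proof. by move=> /subsetP sC; apply: contraNeq => xe; rewrite sC ?suppE. Qed.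

Lemma exists_supp x : x != 0 -> exists e, x e != 0.
Proof.
move=> x0; apply/existsP; apply: contraNT x0; rewrite negb_exists => /forallP xe.
by apply/eqP/ffunP => e; rewrite ffunE; apply/eqP; rewrite -[_ == _]negbK.
Qed.

(** The boundary at [v] only depends on the edges incident to [v]. *)
Lemma boundary_local x y v :
  (forall e, incident v e -> x e = y e) -> boundary x v = boundary y v.
Proof.
move=> xy; rewrite !ffunE; congr (_ - _); apply: eq_bigr => e ev; apply: xy.
  by rewrite /incident ev orbT.
by rewrite /incident ev.
Qed.

Lemma boundary0_local x v :
  (forall e, incident v e -> x e = 0) -> boundary x v = 0.
Proof.
by move=> x0; rewrite (@boundary_local x 0) ?linear0 ?ffunE// => e /x0->; rewrite ffunE.
Qed.

Lemma sum_boundary x : \sum_v boundary x v = 0.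
Proof.
under eq_bigr do rewrite ffunE.
rewrite sumrB.
have E (h : edge G -> vert G) : \sum_v \sum_(e | h e == v) x e = \sum_e x e.
  rewrite (exchange_big_dep predT) //=; apply: eq_bigr => e _.
  by rewrite (eq_bigl (pred1 (h e))) ?big_pred1_eq// => v /=; rewrite eq_sym.
by rewrite !E subrr.
Qed.

Lemma valenceD C D v : [disjoint C & D] ->
  valence (C :|: D) v = (valence C v + valence D v)%N.
Proof.
move=> dCD; rewrite /valence.
have E (P : pred (edge G)) : #|[set e in C :|: D | P e]| =
    (#|[set e in C | P e]| + #|[set e in D | P e]|)%N.
  rewrite -cardsUI [X in (_ + X)%N](_ : _ = 0%N) ?addn0; last first.
    apply/eqP; rewrite cards_eq0; apply/eqP/setP => e; rewrite !inE.
    have /pred0P/(_ e) /= := dCD.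
    by case: (e \in C) => //= ->; rewrite !andbF.
  by apply: eq_card => e; rewrite !inE andb_orl.
by rewrite !E addnACA.
Qed.

Lemma valence_eq0 C v : (valence C v == 0%N) = (v \notin verts C).
Proof.
rewrite /valence addn_eq0 !cards_eq0; apply/idP/idP.
  case/andP => /eqP/setP s0 /eqP/setP t0; apply/vertsP => -[e eC].
  have := s0 e; have := t0 e; rewrite !inE eC /= => et es.
  by rewrite /incident es et.
move=> /vertsP nv; apply/andP; split; apply/eqP/setP => e; rewrite !inE.
  by apply/negP => /andP[eC es]; apply: nv; exists e; rewrite // /incident es.
by apply/negP => /andP[eC es]; apply: nv; exists e; rewrite // /incident es orbT.
Qed.

Lemma sum_valence C : (\sum_v valence C v = 2 * #|C|)%N.
Proof.
rewrite /valence big_split /= mul2n -addnn.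
have E (h : edge G -> vert G) : (\sum_v #|[set e in C | h e == v]| = #|C|)%N.
  under eq_bigr do rewrite -sum1dep_card.
  rewrite (exchange_big_dep (mem C)) /=; last by move=> v e _ /andP[].
  rewrite -sum1_card; apply: eq_bigr => e eC.
  rewrite (eq_bigl (pred1 (h e))) ?big_pred1_eq// => v /=.
  by rewrite eC /= eq_sym.
by rewrite !E.
Qed.

(** A chain on [C] satisfying Kirchhoff's law at a vertex of valence 2 takes the
    same value, up to sign, on the edges of [C] there. *)
Lemma valence2_abs C x v e f : supp x \subset C -> valence C v = 2%N ->
  boundary x v = 0 -> e \in C -> f \in C -> incident v e -> incident v f ->
  x f = x e \/ x f = - x e.
Proof.
move=> sC; rewrite /valence.
set A := [set e in C | src e == v]; set B := [set e in C | tgt e == v] => vC.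
have bE : boundary x v = \sum_(e in B) x e - \sum_(e in A) x e.
  have E (h : edge G -> vert G) :
      \sum_(e | h e == v) x e = \sum_(e in [set e in C | h e == v]) x e.
    rewrite big_mkcond [RHS]big_mkcond /=; apply: eq_bigr => g _.
    rewrite inE; case gC: (g \in C) => //=.
    by rewrite (supp_out sC) ?gC// if_same.
  by rewrite ffunE !E.
rewrite bE => b0 eC fC ev fv.
have {}ev : e \in A :|: B by rewrite !inE eC.
have {}fv : f \in A :|: B by rewrite !inE fC.
case cA : #|A| vC => [|[|[|//]]] vC.
- move: vC; rewrite add0n => /eqP/cards2P[p [q [pq EB]]]; move: b0 ev fv.
  move/eqP: cA; rewrite cards_eq0 => /eqP ->; rewrite big_set0 subr0 EB.
  rewrite big_setU1 ?inE//= big_set1 ?inE /=.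
  move=> pq0 /orP[]/eqP-> /orP[]/eqP->; [left|right|right|left] => //; lra.
- move: vC; rewrite add1n => -[/eqP/cards1P[q EB]]; move/eqP/cards1P: cA => [p EA].
  move: b0 ev fv; rewrite EA EB !big_set1 !inE.
  by move=> pq0 /orP[]/eqP-> /orP[]/eqP->; left; lra.
- have /eqP : #|B| = 0%N by move: vC; case: #|B|.
  move/eqP/cards2P: cA => [p [q [pq EA]]]; move: b0 ev fv.
  rewrite cards_eq0 => + + + /eqP B0; rewrite B0 big_set0 EA.
  rewrite big_setU1 ?inE//= big_set1 ?inE ?orbF /=.
  move=> pq0 /orP[]/eqP-> /orP[]/eqP->; [left|right|right|left] => //; lra.
Qed.

Lemma valence_supp_neq1 x v : boundary x v = 0 -> valence (supp x) v <> 1%N.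
Proof.
rewrite /valence => b0.
have E (h : edge G -> vert G) :
    \sum_(e | h e == v) x e = \sum_(e in [set e in supp x | h e == v]) x e.
  rewrite big_mkcond [RHS]big_mkcond /=; apply: eq_bigr => g _.
  by rewrite !inE; case: (x g =P 0) => //= ->; rewrite if_same.
move: b0; rewrite ffunE !E.
set A := [set e in _ | src e == v]; set B := [set e in _ | tgt e == v].
case cA : #|A| => [|[|//]] b0; rewrite ?add0n ?add1n.
  move=> /eqP/cards1P[q EB]; move: b0.
  move/eqP: cA; rewrite cards_eq0 => /eqP ->.
  rewrite EB big_set0 big_set1 subr0 => q0.
  by have := set11 q; rewrite -EB !inE q0 eqxx.
move=> [/eqP]; rewrite cards_eq0 => /eqP EB; move: b0.
move/eqP/cards1P: cA => [p EA].
rewrite EB EA big_set0 big_set1 sub0r => /eqP; rewrite oppr_eq0 => /eqP p0.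
by have := set11 p; rewrite -EA !inE p0 eqxx.
Qed.

Lemma joined_sym C W : symmetric (joined C W).
Proof.
move=> e f; rewrite /joined andbCA; congr [&& _, _ & _].
by apply: eq_existsb => v; rewrite [incident v e && _]andbC.
Qed.

Lemma joinedP C W e f : reflect
  (exists v, [/\ e \in C, f \in C, v \in W, incident v e & incident v f])
  (joined C W e f).
Proof.
apply: (iffP and3P) => [[eC fC /existsP[v /and3P[]]]|[v [eC fC vW ev fv]]].
  by exists v.
by split=> //; apply/existsP; exists v; rewrite vW ev.
Qed.

(** An invariant of chained edges: a property that passes between joined
    edges spreads along [connect]. *)
Lemma connect_joined_ind C W (P : edge G -> Prop) e f :
  (forall g h, joined C W g h -> P g -> P h) ->
  connect (joined C W) e f -> P e -> P f.
Proof.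
move=> step /connectP[p + ->] {f}; elim: p e => //= g p IH e /andP[eg gp] Pe.
by apply: IH gp _; apply: step eg Pe.
Qed.

End Chains.

(** * Cycles are the supports of elementary homology classes *)

(** Fewer linear equations than unknowns have a nonzero solution. *)
Lemma exists_common_zero (K : fieldType) (vT : vectType K)
    (s : seq 'Hom(vT, K^o)) (U : {vspace vT}) :
  (size s < \dim U)%N ->
  exists x, [/\ x \in U, x != 0 & forall f, f \in s -> f x = 0].
Proof.
elim: s U => [|f s IH] U /= ltU.
  exists (vpick U); rewrite memv_pick vpick0 -dimv_eq0 -lt0n; split=> //.
have := limg_ker_dim f U.
have : (\dim (f @: U) <= 1)%N.
  by rewrite (leq_trans (dimvS (subvf _)))// dimvf /dim /= ?muln1.
move=> le1 dU.
have [|x [xU x0 xs]] := IH (U :&: lker f)%VS; first by lia.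
move: xU; rewrite memv_cap memv_ker => /andP[xU /eqP fx].
exists x; split=> // g; rewrite inE => /orP[/eqP->//|]; exact: xs.
Qed.

Section Cycles.
Variable G : graph.
Implicit Types (C D S : {set edge G}) (W : {set vert G}) (v : vert G)
  (e f g h : edge G) (x y z : {ffun edge G -> rat^o}).

(** Evaluation at an edge, and boundary at a vertex, as linear forms. *)
Definition edge_coord e x : rat^o := x e.
Definition boundary_at v x : rat^o := boundary x v.

Fact edge_coord_is_linear e : linear (edge_coord e).
Proof. by move=> k x y; rewrite /edge_coord !ffunE. Qed.
HB.instance Definition _ e := GRing.isLinear.Build rat
  {ffun edge G -> rat^o} rat^o *:%R (edge_coord e)
  (edge_coord_is_linear e).

Fact boundary_at_is_linear v : linear (boundary_at v).
Proof. by move=> k x y; rewrite /boundary_at linearP !ffunE. Qed.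
HB.instance Definition _ v := GRing.isLinear.Build rat
  {ffun edge G -> rat^o} rat^o *:%R (boundary_at v)
  (boundary_at_is_linear v).

(** There is a nonzero chain on [C] obeying fewer than [#|C|] conditions, each being Kirchhoff's
    law at a vertex of [W] or vanishing on an edge of [S]. *)
Lemma exists_chain C W S : (#|W| + #|S| < #|C|)%N ->
  exists x, [/\ supp x \subset C, x != 0,
    forall v, v \in W -> boundary x v = 0 & forall e, e \in S -> x e = 0].
Proof.
move=> ltC.
pose ce e : 'Hom({ffun edge G -> rat^o}, rat^o) :=
  linfun (edge_coord e).
pose bv v : 'Hom({ffun edge G -> rat^o}, rat^o) :=
  linfun (boundary_at v).
have [|x [_ x0 xs]] := @exists_common_zero _ _
    ([seq ce e | e <- enum (~: C) ++ enum S] ++ [seq bv v | v <- enum W]) fullv.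
  rewrite size_cat !size_map size_cat -!cardE dimvf /dim /= muln1.
  by rewrite -(cardsC C) [ltnRHS]addnC -addnA ltn_add2l addnC.
exists x; split=> //.
- apply/subsetP => e; rewrite suppE; apply: contraR => eC.
  have := xs (ce e); rewrite lfunE /= /edge_coord => -> //.
  by rewrite mem_cat map_f ?orbT// mem_cat mem_enum inE eC.
- move=> v vW; have := xs (bv v); rewrite lfunE /= /boundary_at => -> //.
  by rewrite mem_cat (map_f bv) ?orbT// mem_enum.
- move=> e eS; have := xs (ce e); rewrite lfunE /= /edge_coord => -> //.
  by rewrite mem_cat map_f ?orbT// mem_cat !mem_enum eS orbT.
Qed.

Lemma boundary_eq0P x : (forall v, boundary x v = 0) -> boundary x = 0.
Proof. by move=> b0; apply/ffunP => v; rewrite b0 ffunE. Qed.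

Lemma boundaryE0 x v : boundary x = 0 -> boundary x v = 0.
Proof. by move=> ->; rewrite ffunE. Qed.

(** As boundaries have sum zero, Kirchhoff's law may be left out at one
    vertex. *)
Lemma boundary_eq0_but1 x p : (forall v, v != p -> boundary x v = 0) ->
  boundary x = 0.
Proof.
move=> b0; apply: boundary_eq0P => v; have [->|/b0//] := eqVneq v p.
by have := sum_boundary x; rewrite (bigD1 p) //= [X in _ + X]big1 ?addr0.
Qed.

Lemma boundary_supp x v : v \notin verts (supp x) -> boundary x v = 0.
Proof.
move=> /vertsP nv; apply: boundary0_local => e ev; apply/eqP/negPn/negP => xe.
by apply: nv; exists e; rewrite ?suppE.
Qed.

Lemma vertsS C D : C \subset D -> verts C \subset verts D.
Proof.
move=> /subsetP sCD; apply/subsetP => v /vertsP[e eC ev].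
by apply/vertsP; exists e; rewrite ?sCD.
Qed.

(** The part of a homology class carried by a union of components of its
    support is a homology class. *)
Lemma boundary_restr_closed D x : boundary x = 0 ->
  (forall v e f, incident v e -> incident v f -> x e != 0 -> x f != 0 ->
     e \in D -> f \in D) ->
  boundary (restr D x) = 0.
Proof.
move=> bx clD; apply: boundary_eq0P => v.
have [/existsP[e /and3P[ev eD xe]]|/existsPn nD] :=
  boolP [exists e, [&& incident v e, e \in D & x e != 0]].
  rewrite (@boundary_local _ _ x) ?boundaryE0// => f fv; rewrite ffunE.
  case: ifP => // /negbT fD; apply/esym/eqP/negPn/negP => xf.
  by move: fD; rewrite (clD v e f).
apply: boundary0_local => f fv; rewrite ffunE; case: ifP => // fD.
by apply/eqP; move: (nD f); rewrite fv fD /= negbK.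
Qed.

(** A homology class of minimal support is carried by a cycle. *)
Lemma is_cycle_supp x : boundary x = 0 -> x != 0 ->
  (forall y, boundary y = 0 -> y != 0 -> supp y \subset supp x ->
     supp x \subset supp y) -> is_cycle (supp x).
Proof.
move=> bx x0 xmin.
have [e xe] := exists_supp x0.
set C := supp x.
(* Otherwise some class on [C] vanishes at [e], against minimality. *)
have card_le : (#|C| <= #|verts C|)%N.
  rewrite leqNgt; apply/negP => ltC.
  have src_e : src e \in verts C.
    by apply/vertsP; exists e; rewrite ?suppE// incident_src.
  have [|y [yC y0 yW ye]] := @exists_chain C (verts C :\ src e) [set e].
    by have := cardsD1 (src e) (verts C); rewrite src_e cards1 /=; lia.
  have by0 : boundary y = 0.
    apply: (@boundary_eq0_but1 _ (src e)) => v vse.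
    have [vC|vC] := boolP (v \in verts C); first by apply: yW; rewrite in_setD1 vse.
    by apply: boundary_supp; apply: contraNN vC; exact: (subsetP (vertsS yC)).
  have /subsetP/(_ e) := xmin _ by0 y0 yC.
  by rewrite !suppE ye ?inE// eqxx => /(_ xe).
have val_ge v : v \in verts C -> (2 <= valence C v)%N.
  move=> vC; have := valence_supp_neq1 (boundaryE0 v bx).
  by have := valence_eq0 C v; rewrite vC -/C; case: valence => [|[]].
(* The valences add up to [2 * #|C|], at most twice the number of vertices. *)
have val_eq v : v \in verts C -> valence C v = 2%N.
  have sumE : (\sum_(v in verts C) valence C v = 2 * #|C|)%N.
    rewrite -sum_valence [RHS](bigID (mem (verts C))) /= [X in (_ + X)%N]big1 ?addn0//.
    by move=> w; rewrite -valence_eq0 => /eqP.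
  have := leqif_sum (fun v (vC : v \in verts C) => leqif_eq (val_ge v vC)).
  rewrite sumE sum_nat_const => -[_ /esym].
  have -> : (#|verts C| * 2 == 2 * #|C|)%N.
    rewrite mulnC eqn_leq !leq_mul2l /= card_le.
    have : (\sum_(v in verts C) 2 <= \sum_(v in verts C) valence C v)%N by apply: leq_sum.
    by rewrite sumE sum_nat_const mulnC !leq_mul2l andbT.
  by move=> /forall_inP vE vC; apply/esym/eqP/vE.
apply/and3P; split.
- by apply/set0Pn; exists e; rewrite suppE.
- apply/forallP => v; have [/val_eq->|] := boolP (v \in verts C); first by rewrite eqxx orbT.
  by rewrite -valence_eq0 => ->.
apply/forall_inP => f fC; apply/forall_inP => g gC.
pose D := [set h | connect (joined C setT) f h].
have bD : boundary (restr D x) = 0.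
  apply: boundary_restr_closed => // v h k hv kv xh xk; rewrite !inE => fh.
  apply: connect_trans fh (connect1 _); apply/joinedP.
  by exists v; rewrite !suppE inE.
have D0 : restr D x != 0.
  apply/eqP => /ffunP/(_ f); rewrite !ffunE inE connect0.
  by apply/eqP; rewrite -suppE.
have sD : supp (restr D x) \subset C.
  by apply/subsetP => h; rewrite !suppE ffunE; case: ifP => //; rewrite eqxx.
have /subsetP/(_ g gC) := xmin _ bD D0 sD.
by rewrite suppE ffunE; case: ifP; rewrite ?inE// eqxx.
Qed.

Lemma cycle_valence C v : is_cycle C -> v \in verts C -> valence C v = 2%N.
Proof.
case/and3P => _ /forallP /(_ v) + _ => /orP[]; last by move/eqP.
by rewrite valence_eq0 => /negbTE->.
Qed.

Lemma cycle_connect C e f : is_cycle C -> e \in C -> f \in C ->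
  connect (joined C setT) e f.
Proof. by case/and3P => _ _ /forall_inP cC eC fC; have /forall_inP := cC e eC; exact. Qed.

Lemma cycle_neq0 C : is_cycle C -> exists e, e \in C.
Proof. by case/and3P => /set0Pn. Qed.

(** A homology class carried by a cycle is a multiple of its fundamental
    class. *)
Lemma cycle_const C x e f : is_cycle C -> boundary x = 0 ->
  supp x \subset C -> e \in C -> f \in C -> x f = x e \/ x f = - x e.
Proof.
move=> cC bx xC eC fC.
apply: (@connect_joined_ind _ C setT (fun g => x g = x e \/ x g = - x e) e f);
  [|exact: cycle_connect|by left].
move=> g h /joinedP[v [gC hC _ gv hv]].
have vC : v \in verts C by apply/vertsP; exists g.
have := valence2_abs xC (cycle_valence cC vC) (boundaryE0 v bx) gC hC gv hv.
by move=> [->|->] [->|->]; rewrite ?opprK; auto.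
Qed.

(** The fundamental class of a cycle, normalised at an edge. *)
Lemma cycle_chain C e : is_cycle C -> e \in C -> exists x,
  [/\ boundary x = 0, supp x = C, x e = 1
    & forall f, x f = 0 \/ x f = 1 \/ x f = -1].
Proof.
move=> cC eC.
have cardC : #|verts C| = #|C|.
  apply/eqP; rewrite -(@eqn_pmul2l 2)// -sum_valence.
  rewrite (bigID (mem (verts C))) /= [X in _ == (_ + X)%N]big1 ?addn0//; last first.
    by move=> w; rewrite -valence_eq0 => /eqP.
  under eq_bigr do rewrite (cycle_valence cC)//.
  by rewrite sum_nat_const mulnC.
have src_e : src e \in verts C by apply/vertsP; exists e; rewrite ?incident_src.
have [|x [xC x0 xW _]] := @exists_chain C (verts C :\ src e) set0.
  by have := cardsD1 (src e) (verts C); rewrite src_e cards0 /=; lia.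
have bx : boundary x = 0.
  apply: (@boundary_eq0_but1 _ (src e)) => v vse.
  have [vC|vC] := boolP (v \in verts C); first by apply: xW; rewrite in_setD1 vse.
  by apply: boundary_supp; apply: contraNN vC; exact: (subsetP (vertsS xC)).
have xe : x e != 0.
  apply: contraNneq x0 => xe; apply/eqP/ffunP => f; rewrite ffunE.
  have [fC|fC] := boolP (f \in C); last exact: supp_out xC fC.
  by have := cycle_const cC bx xC eC fC; rewrite xe oppr0 => -[].
exists ((x e)^-1 *: x).
have vE f : ((x e)^-1 *: x) f = (x e)^-1 * x f by rewrite ffunE.
have onC f : f \in C -> (x e)^-1 * x f = 1 \/ (x e)^-1 * x f = -1.
  move=> fC; have [->|->] := cycle_const cC bx xC eC fC.
    by left; rewrite mulVf.
  by right; rewrite mulrN mulVf.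
split; rewrite ?vE ?mulVf//.
- by rewrite linearZ /= bx scaler0.
- apply/setP => f; rewrite suppE vE; have [fC|fC] := boolP (f \in C).
    by have [->|->] := onC f fC; rewrite ?oppr_eq0 oner_eq0.
  by rewrite (supp_out xC fC) mulr0 eqxx.
- move=> f; rewrite vE; have [fC|fC] := boolP (f \in C); first by right; apply: onC.
  by left; rewrite (supp_out xC fC) mulr0.
Qed.

(** Every edge of the support of a homology class lies on a cycle contained
    in that support: take a class of minimal support among those that are
    nonzero on the edge. *)
Lemma cycle_through x e : boundary x = 0 -> x e != 0 -> exists y,
  [/\ boundary y = 0, supp y \subset supp x, is_cycle (supp y), y e = 1
    & forall f, y f = 0 \/ y f = 1 \/ y f = -1].
Proof.
move: {2}(#|supp x|) (leqnn #|supp x|) => n; elim: n x => [|n IH] x.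
  rewrite leqn0 cards_eq0 => /eqP s0 _ xe.
  by have := suppE x e; rewrite s0 inE xe.
move=> sn bx xe.
have [[y [by0 yx ye ltyx]]|xmin] := EM (exists y,
    [/\ boundary y = 0, supp y \subset supp x, y e != 0 & supp y \proper supp x]).
  have [|z [bz zy ? ? ?]] := IH y _ by0 ye.
    by have := proper_card ltyx; lia.
  by exists z; split=> //; apply: subset_trans yx.
have cx : is_cycle (supp x).
  apply: is_cycle_supp => //; first by apply: contraNneq xe => ->; rewrite ffunE.
  move=> y by0 y0 yx; apply: contrapT => nxy; apply: xmin.
  have pyx : supp y \proper supp x by rewrite properE yx; apply/negP.
  have [ye|ye] := eqVneq (y e) 0; last by exists y.
  (* Subtracting a multiple of [y] kills the coordinate of [x] at [f]. *)
  have [f yf] := exists_supp y0.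
  have xf : x f != 0 by rewrite -suppE (subsetP yx)// suppE.
  exists (x - (x f / y f) *: y).
  have vE g : (x - (x f / y f) *: y) g = x g - x f / y f * y g.
    by rewrite !ffunE.
  have sub : supp (x - (x f / y f) *: y) \subset supp x.
    apply/subsetP => g; rewrite !suppE vE; apply: contraNneq => xg.
    by rewrite xg (supp_out (e := g) yx) ?suppE ?xg ?eqxx// mulr0 subr0.
  split=> //.
  - by rewrite linearB linearZ /= bx by0 scaler0 subr0.
  - by rewrite vE ye mulr0 subr0.
  - rewrite properE sub; apply/subsetPn; exists f; rewrite ?suppE//.
    by rewrite vE divfK// subrr eqxx.
have [|z [bz zx ze zv]] := @cycle_chain (supp x) e cx; first by rewrite suppE.
by exists z; split; rewrite ?zx.
Qed.

Lemma mem_cyclicP e :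
  reflect (exists2 x : {ffun edge G -> rat^o}, boundary x = 0 & x e != 0)
    (e \in cyclic_edges G).
Proof.
rewrite inE; apply: (iffP existsP) => [[C /andP[cC eC]]|[x bx xe]].
  have [x [bx _ xe _]] := cycle_chain cC eC.
  by exists x; rewrite // xe oner_eq0.
have [y [_ _ cy ye _]] := cycle_through bx xe.
by exists (supp y); rewrite cy suppE ye oner_eq0.
Qed.

Lemma supp_cyclic x : boundary x = 0 -> supp x \subset cyclic_edges G.
Proof.
by move=> bx; apply/subsetP => e; rewrite suppE => xe; apply/mem_cyclicP; exists x.
Qed.

(** A function of total zero on the vertices of a cycle is the boundary of a
    chain on this cycle. Only the connectedness of the cycle matters. *)
Lemma fill_cycle C (b : {ffun vert G -> rat^o}) : is_cycle C ->
  (forall v, v \notin verts C -> b v = 0) -> \sum_v b v = 0 ->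
  exists2 y, supp y \subset C & boundary y = b.
Proof.
move=> cC bC b0.
pose delta v : {ffun vert G -> rat^o} := [ffun w => (w == v)%:R].
pose P (h : {ffun vert G -> rat^o}) := exists2 y, supp y \subset C & boundary y = h.
have P0 : P 0.
  exists 0; rewrite ?linear0//; apply/subsetP => e.
  by rewrite suppE ffunE eqxx.
have PZD (k : rat) (h1 h2 : {ffun vert G -> rat^o}) : P h1 -> P h2 -> P (k *: h1 + h2).
  move=> [y1 s1 <-] [y2 s2 <-]; exists (k *: y1 + y2); last by rewrite linearP.
  apply/subsetP => e; apply: contraTT => eC.
  by rewrite suppE negbK !ffunE (supp_out s1 eC) (supp_out s2 eC) scaler0 addr0.
have Pedge e : e \in C -> P (delta (tgt e) - delta (src e)).
  move=> eC; exists [ffun f => (f == e)%:R].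
    apply/subsetP => f; rewrite suppE ffunE; case: (eqVneq f e) => [-> _ //|_].
    by rewrite mulr0n eqxx.
  have E (h : edge G -> vert G) v : \sum_(f | h f == v)
      ([ffun f : edge G => (f == e)%:R] : {ffun edge G -> rat^o}) f = (v == h e)%:R :> rat.
    rewrite big_mkcond (bigD1 e) //= big1 ?addr0 => [|f fe].
      by rewrite ffunE eqxx eq_sym; case: eqP.
    by rewrite ffunE (negbTE fe) if_same.
  by apply/ffunP => v; rewrite !ffunE !E.
have [e eC] := cycle_neq0 cC; pose p := src e.
have Pinc f v : f \in C -> incident v f -> P (delta v - delta p) -> 
    forall w, incident w f -> P (delta w - delta p).
  move=> fC vf Pv w wf.
  have := Pedge f fC => Pf.
  have Pf' : P (delta (src f) - delta (tgt f)).
    by have := PZD (-1) _ _ Pf P0; rewrite scaleN1r opprB addr0.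
  have PD (h1 h2 : {ffun vert G -> rat^o}) : P h1 -> P h2 -> P (h1 + h2).
    by move=> H1 H2; have := PZD 1 _ _ H1 H2; rewrite scale1r.
  move: Pv; case/orP: vf => /eqP <- Pv; case/orP: wf => /eqP <- //.
    by have := PD _ _ Pf Pv; rewrite addrA subrK.
  by have := PD _ _ Pf' Pv; rewrite addrA subrK.
have Pv v : v \in verts C -> P (delta v - delta p).
  move=> /vertsP[f fC fv]; move: v fv.
  apply: (@connect_joined_ind _ C setT
      (fun g => forall v, incident v g -> P (delta v - delta p)) e f).
  - move=> g h /joinedP[v [gC hC _ gv hv]] IH w wh.
    by apply: Pinc hC hv _ w wh; apply: IH.
  - exact: cycle_connect.
  - by apply: (Pinc e p) => //; rewrite ?incident_src// subrr.
have -> : b = \sum_v b v *: (delta v - delta p).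
  under eq_bigr do rewrite scalerBr.
  rewrite sumrB -scaler_suml b0 scale0r subr0.
  apply/ffunP => w; rewrite sum_ffunE (bigD1 w) //= big1 ?addr0 => [|v vw].
    by rewrite !ffunE eqxx; exact/esym/mulr1.
  by rewrite !ffunE eq_sym (negbTE vw); exact: mulr0.
apply: (big_ind P) => //.
  by move=> h1 h2 H1 H2; have := PZD 1 _ _ H1 H2; rewrite scale1r.
move=> v _; have [vC|vC] := boolP (v \in verts C).
  by rewrite -[_ *: _]addr0; apply: PZD => //; apply: Pv.
by rewrite bC// scale0r.
Qed.

End Cycles.

(** * Graphs of genus 2 *)

Lemma sign_eq (p q eps : rat) : p = 0 \/ p = 1 \/ p = -1 ->
  q = 0 \/ q = 1 \/ q = -1 -> p != 0 -> q != 0 -> eps = 1 \/ eps = -1 ->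
  let r := p - eps * q in r = 0 \/ r = 1 \/ r = -1 -> p = eps * q.
Proof.
move=> /= [->|[->|->]] [->|[->|->]]; rewrite ?eqxx// => _ _ [->|->] [|[]]; lra.
Qed.

Section GenusTwo.
Variable G : graph.
Implicit Types (C D S : {set edge G}) (v : vert G) (e f g h : edge G)
  (x y z a : {ffun edge G -> rat^o}).

Lemma mem_H1 x : (x \in lker (linfun (@boundary G rat))) = (boundary x == 0).
Proof. by rewrite memv_ker lfunE. Qed.

(** The cyclic edges on which every homology class vanishing on [f] vanishes,
    i.e. those whose coordinate functional on [H_1] is proportional to that of
    [f]. *)
Definition parallel f : {set edge G} :=
  [set g in cyclic_edges G |
    `[< forall x, boundary x = 0 -> x f = 0 -> x g = 0 >]].

Lemma parallelP f g : reflect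
  (g \in cyclic_edges G /\ forall x, boundary x = 0 -> x f = 0 -> x g = 0)
  (g \in parallel f).
Proof. by rewrite [g \in parallel f]in_set; apply: (iffP andP) => -[gc /asboolP]. Qed.

(** The edges carrying the first but not the second of two chains. *)
Definition only1 a1 a2 := supp a1 :\: supp a2.
(** The edges carrying both chains. *)
Definition both a1 a2 := supp a1 :&: supp a2.

Lemma only1E a1 a2 e : (e \in only1 a1 a2) = (a1 e != 0) && (a2 e == 0).
Proof. by rewrite !inE negbK andbC. Qed.

Lemma bothE a1 a2 e : (e \in both a1 a2) = (a1 e != 0) && (a2 e != 0).
Proof. by rewrite !inE. Qed.

(** A basis of [H_1] made of fundamental classes of cycles, dual to the
    coordinates at [e1] and [e2]. *)
Definition cycle_basis e1 e2 a1 a2 : Prop :=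
  [/\ boundary a1 = 0 /\ boundary a2 = 0, a1 e1 = 1 /\ a1 e2 = 0,
      a2 e1 = 0 /\ a2 e2 = 1, is_cycle (supp a1) /\ is_cycle (supp a2)
    & forall x, boundary x = 0 -> forall e, x e = x e1 * a1 e + x e2 * a2 e].

Hypothesis genus2 : genus G = 2%N.

Lemma exists_vanishing f : exists z, [/\ boundary z = 0, z != 0 & z f = 0].
Proof.
have [|z [zV z0 zf]] := @exists_common_zero _ _ [:: linfun (@edge_coord G f)]
    (lker (linfun (@boundary G rat))).
  by move: genus2; rewrite /genus => ->.
exists z; split=> //; first by apply/eqP; rewrite -mem_H1.
by have := zf _ (mem_head _ _); rewrite lfunE.
Qed.

Lemma spanned f x z y : boundary x = 0 -> boundary z = 0 -> boundary y = 0 ->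
  x f != 0 -> z f = 0 -> z != 0 ->
  exists k : rat, forall e, y e = y f / x f * x e + k * z e.
Proof.
move=> bx bz by0 xf zf z0.
pose V := lker (linfun (@boundary G rat)).
pose c := linfun (@edge_coord G f).
have cE w : c w = w f by rewrite lfunE.
have dV : \dim V = 2 by exact: genus2.
have memU w : boundary w = 0 -> w f = 0 -> w \in (V :&: lker c)%VS.
  by move=> bw wf; rewrite memv_cap mem_H1 bw memv_ker cE wf !eqxx.
have dU : (\dim (V :&: lker c) <= 1)%N.
  have := limg_ker_dim c V; rewrite dV.
  have : (0 < \dim (c @: V))%N.
    rewrite lt0n dimv_eq0; apply: contraNneq xf => im0.
    have := memv_img c (_ : x \in V); rewrite im0 memv0 cE => /(_ _)/eqP->//.
    by rewrite mem_H1 bx.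
  by lia.
have UE : (<[z]> == V :&: lker c)%VS.
  by rewrite eqEdim -memvE memU//= dim_vline z0.
have : y - (y f / x f) *: x \in (V :&: lker c)%VS.
  apply: memU; first by rewrite linearB linearZ /= bx by0 scaler0 subr0.
  by rewrite !ffunE [_ *: _]divfK// subrr.
rewrite -(eqP UE) => /vlineP[k yE]; exists k => e.
move/ffunP/(_ e): yE; rewrite !ffunE => /eqP.
by rewrite subr_eq addrC => /eqP.
Qed.

(** The edges linked to [f] through vertices of valence 2 are exactly those
    parallel to [f]. The complement of [parallel f] in the cyclic edges is a
    cycle [Z]. The ends of the part [D] of [parallel f] linked to [f] lie on [Z],
    and closing [D] up along [Z] gives a homology class that vanishes on the rest
    of [parallel f] but not at [f]; so there is no rest. *)
Lemma connect_parallel f g : f \in cyclic_edges G ->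
  connect (joined (cyclic_edges G)
    [set v | valence (cyclic_edges G) v == 2%N]) f g = (g \in parallel f).
Proof.
set J := joined _ _ => fc.
apply/idP/idP.
  move=> fg.
  apply: (@connect_joined_ind _ _ _ (fun h => h \in parallel f) f g _ fg); last first.
    by apply/parallelP; split.
  move=> h k /joinedP[v [hc kc]]; rewrite inE => /eqP v2 hv kv /parallelP[_ hp].
  apply/parallelP; split=> // x bx xf.
  have := valence2_abs (supp_cyclic bx) v2 (boundaryE0 v bx) hc kc hv kv.
  by rewrite hp// oppr0 => -[].
move=> /parallelP[gc gp]; pose D := [set h | connect J f h].
have [z [bz z0 zf]] := exists_vanishing f.
have [x0 bx0 x0f] := mem_cyclicP _ fc.
have [x [bx _ cx xf _]] := cycle_through bx0 x0f.
have xf0 : x f != 0 by rewrite xf oner_eq0.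
have cz : is_cycle (supp z).
  apply: is_cycle_supp => // y by0 y0 yz.
  have yf : y f = 0 by apply: (supp_out yz); rewrite suppE zf eqxx.
  have [k yE] := spanned bx bz by0 xf0 zf z0.
  apply/subsetP => e; rewrite !suppE; apply: contraNneq => ye.
  move: (yE e); rewrite yf ye mul0r mul0r add0r => /esym/eqP.
  rewrite mulf_eq0 => /orP[/eqP k0|//]; case/eqP: y0; apply/ffunP => h.
  by rewrite yE yf k0 ffunE !mul0r addr0.
have zpar h : z h = 0 -> forall y, boundary y = 0 -> y f = 0 -> y h = 0.
  move=> zh y by0 yf; have [k ->] := spanned bx bz by0 xf0 zf z0.
  by rewrite yf zh !(mul0r, mulr0) addr0.
have znz h : h \in cyclic_edges G -> z h = 0 -> x h != 0.
  move=> /mem_cyclicP[y by0 yh] zh; apply: contraNneq yh => xh.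
  by have [k ->] := spanned bx bz by0 xf0 zf z0; rewrite xh zh !mulr0 addr0.
have Dc h : h \in D -> h \in cyclic_edges G.
  rewrite inE => fh.
  apply: (@connect_joined_ind _ _ _ (fun h => h \in cyclic_edges G) f h _ fh fc).
  by move=> ? ? /joinedP[? []].
pose y := restr D x.
have [y' sy' by'] : exists2 y', supp y' \subset supp z & boundary y' = boundary y.
  apply: fill_cycle => //; last exact: sum_boundary.
  move=> v vz; have [v2|v2] := eqVneq (valence (cyclic_edges G) v) 2%N; last first.
    apply: boundary0_local => h hv; rewrite ffunE; case: ifP => // hD.
    exfalso; apply/negP: v2; rewrite negbK.
    (* Away from [Z] the curve runs along the cycle carrying [x]. *)
    have vx : v \in verts (supp x).
      apply/vertsP; exists h; rewrite ?suppE ?znz ?Dc//.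
      apply/eqP; apply: contraNT vz => zh; apply/vertsP.
      by exists h; rewrite ?suppE.
    rewrite -(cycle_valence cx vx) /valence; apply/eqP.
    have E (s : edge G -> vert G) : (forall k, s k == v -> incident v k) ->
        #|[set k in cyclic_edges G | s k == v]| = #|[set k in supp x | s k == v]|.
      move=> sv; apply: eq_card => k; rewrite 2!in_set; case kv: (s k == v); last by rewrite !andbF.
      rewrite !andbT; apply/idP/idP => [kc|/(subsetP (supp_cyclic bx))//].
      rewrite suppE znz//; apply/eqP; apply: contraNT vz => zk; apply/vertsP.
      by exists k; rewrite ?suppE ?sv.
    by congr (_ + _)%N; apply: E => k kv; rewrite /incident kv ?orbT.
  have [/existsP[h /andP[hv hD]]|/existsPn nD] :=
      boolP [exists h, incident v h && (h \in D)].
    rewrite -(boundaryE0 v bx); apply: boundary_local => k kv; rewrite ffunE.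
    case: ifP => // /negbT kD; apply/esym/eqP; apply: contraNT kD => xk.
    have kc : k \in cyclic_edges G by apply: (subsetP (supp_cyclic bx)); rewrite suppE.
    move: (hD); rewrite !inE => fh; apply: connect_trans fh (connect1 _).
    by apply/joinedP; exists v; rewrite inE v2 kc Dc.
  apply: boundary0_local => k kv; rewrite ffunE; case: ifP => // kD.
  by move: (nD k); rewrite kv kD.
have y'0 h : z h = 0 -> y' h = 0.
  by move=> zh; apply: (supp_out sy'); rewrite suppE zh eqxx.
have fD : f \in D by rewrite inE connect0.
have bw : boundary (x - (y - y')) = 0.
  by rewrite 2!(linearB (@boundary G rat)) /= bx by' subrr subr0.
have := gp _ bw.
have zg : z g = 0 by apply: gp.
have wE h : z h = 0 ->
    (x - (y - y')) h = x h - (if h \in D then x h else 0).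
  by move=> zh; rewrite !ffunE [y' h]y'0// subr0.
rewrite !wE// fD subrr => /(_ erefl); case: ifP => [|_ /eqP]; first by rewrite inE.
by rewrite subr0 (negbTE (znz _ _ _)).
Qed.

Lemma parallel_eq f g : f \in cyclic_edges G -> g \in parallel f ->
  parallel g = parallel f.
Proof.
move=> fc gf; have [gc _] := parallelP _ _ gf; apply/setP => h.
rewrite -!connect_parallel//; apply/esym/same_connect; last by rewrite connect_parallel.
exact: sym_connect_sym (@joined_sym _ _ _).
Qed.

Lemma segmentsP S :
  reflect (exists2 f, f \in cyclic_edges G & S = parallel f) (S \in segments G).
Proof.
have E f : f \in cyclic_edges G -> [set g in cyclic_edges G |
   connect (joined (cyclic_edges G)
     [set v | valence (cyclic_edges G) v == 2%N]) f g] = parallel f.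
  move=> fc; apply/setP => g; rewrite inE connect_parallel//.
  by apply: andb_idl => /parallelP[].
apply: (iffP imsetP) => -[f fc ->]; exists f; rewrite ?E//.
Qed.

Lemma exists_cycle_basis e1 e2 x1 x2 : boundary x1 = 0 -> boundary x2 = 0 ->
  x1 e1 != 0 -> x1 e2 = 0 -> x2 e1 = 0 -> x2 e2 != 0 ->
  exists a1 a2, cycle_basis e1 e2 a1 a2.
Proof.
move=> bx1 bx2 x11 x12 x21 x22.
have [a1 [ba1 s1 c1 a11 _]] := cycle_through bx1 x11.
have [a2 [ba2 s2 c2 a22 _]] := cycle_through bx2 x22.
have a12 : a1 e2 = 0 by apply: (supp_out s1); rewrite suppE x12 eqxx.
have a21 : a2 e1 = 0 by apply: (supp_out s2); rewrite suppE x21 eqxx.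
exists a1, a2; split=> // x bx e.
have a20 : a2 != 0 by apply: contra_eqN a22 => /eqP->; rewrite ffunE eq_sym oner_eq0.
have [|k xE] := spanned ba1 ba2 bx _ a21 a20; first by rewrite a11 oner_eq0.
have := xE e2; rewrite a12 a22 mulr0 add0r mulr1 => ->.
by rewrite [x e]xE a11 divr1.
Qed.

Lemma exists_basis : exists e1 e2 a1 a2, cycle_basis e1 e2 a1 a2.
Proof.
have [e0 _] : exists e0 : edge G, true.
  apply/existsP; apply: contraPT (genus2) => /existsPn nE.
  have : (\dim (lker (linfun (@boundary G rat))) <= 0)%N.
    rewrite leqn0 dimv_eq0 -subv0; apply/subvP => x _; rewrite memv0.
    by apply/eqP/ffunP => e; have := nE e.
  by rewrite -/(genus G) => + E; rewrite E.
have [x [bx x0 _]] := exists_vanishing e0.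
have [e1 x1] := exists_supp x0.
have [z [bz z0 z1]] := exists_vanishing e1.
have [e2 z2] := exists_supp z0.
exists e1, e2; apply: (@exists_cycle_basis e1 e2 (x - (x e2 / z e2) *: z) z) => //.
- by rewrite linearB linearZ /= bx bz scaler0 subr0.
- by rewrite !ffunE z1 scaler0 subr0.
- by rewrite !ffunE [_ *: _]divfK// subrr.
Qed.

Section Basis.
Variables (e1 e2 : edge G) (a1 a2 : {ffun edge G -> rat^o}).
Hypothesis ba : cycle_basis e1 e2 a1 a2.

Lemma basis_unit e : (a1 e = 0 \/ a1 e = 1 \/ a1 e = -1) /\
  (a2 e = 0 \/ a2 e = 1 \/ a2 e = -1).
Proof.
case: ba => -[b1 b2] [a11 _] [_ a22] [c1 c2] _.
have E a f : boundary a = 0 -> a f = 1 -> is_cycle (supp a) ->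
    a e = 0 \/ a e = 1 \/ a e = -1.
  move=> bA af ca; have [ae|ae] := eqVneq (a e) 0; [by left|right].
  rewrite -{1}af -{1}af; apply: (@cycle_const _ (supp a)); rewrite ?suppE//.
  by rewrite af oner_eq0.
by split; [apply: (E a1 e1)|apply: (E a2 e2)].
Qed.

Lemma cyclic_basis e : (e \in cyclic_edges G) = (a1 e != 0) || (a2 e != 0).
Proof.
case: ba => -[b1 b2] _ _ _ aE; apply/idP/idP.
  move=> /mem_cyclicP[x bx]; apply: contraNT; rewrite negb_or !negbK.
  by move=> /andP[/eqP a1e /eqP a2e]; rewrite (aE x bx) a1e a2e !mulr0 addr0.
by move=> /orP[] ae; apply/mem_cyclicP; [exists a1|exists a2].
Qed.

Lemma parallel_basis1 : parallel e1 = only1 a1 a2.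
Proof.
case: (ba) => -[b1 b2] _ [a21 _] _ aE; apply/setP => g; rewrite only1E.
apply/parallelP/andP => [[gc gp]|[a1g /eqP a2g]].
  have a2g : a2 g = 0 by apply: gp.
  by move: gc; rewrite cyclic_basis a2g eqxx orbF.
rewrite cyclic_basis a1g; split=> // x bx x1.
by rewrite (aE x bx) x1 a2g mul0r mulr0 addr0.
Qed.

Lemma parallel_basis2 : parallel e2 = only1 a2 a1.
Proof.
case: (ba) => -[b1 b2] [_ a12] _ _ aE; apply/setP => g; rewrite only1E.
apply/parallelP/andP => [[gc gp]|[a2g /eqP a1g]].
  have a1g : a1 g = 0 by apply: gp.
  by move: gc; rewrite cyclic_basis a1g eqxx.
rewrite cyclic_basis a2g orbT; split=> // x bx x2.
by rewrite (aE x bx) x2 a1g mul0r mulr0 addr0.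
Qed.

(** Unimodularity: the two basis cycles run everywhere with the same, or
    everywhere with the opposite, relative orientation along their common part.
    When there is a common part, the rest of the two cycles is a cycle too. *)
Lemma basis_sign e3 : e3 \in both a1 a2 -> exists eps : rat,
  [/\ eps = 1 \/ eps = -1, forall e, e \in both a1 a2 -> a1 e = eps * a2 e
    & is_cycle (only1 a1 a2 :|: only1 a2 a1)].
Proof.
rewrite bothE => /andP[a13 a23].
case: (ba) => -[b1 b2] [a11 a12] [a21 a22] _ aE.
have [u1 u2] := basis_unit e3.
pose eps := a1 e3 * a2 e3.
have eps1 : eps = 1 \/ eps = -1.
  rewrite /eps; case: u1 a13 => [->|[->|->]]; case: u2 a23 => [->|[->|->]];
    rewrite ?eqxx// => _ _; [left|right|right|left]; lra.
have epsE : a1 e3 = eps * a2 e3.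
  by rewrite /eps; case: u2 a23 => [->|[->|->]]; rewrite ?eqxx// => _; lra.
pose z : {ffun edge G -> rat^o} := a1 - eps *: a2.
have zE e : z e = a1 e - eps * a2 e by rewrite !ffunE.
have z3 : z e3 = 0 by rewrite zE -epsE subrr.
have bz : boundary z = 0 by rewrite linearB linearZ /= b1 b2 scaler0 subr0.
have z1 : z e1 = 1 by rewrite zE a11 a21 mulr0 subr0.
have [|y [by0 yz cy y1 yv]] := @cycle_through _ z e1 bz; first by rewrite z1 oner_eq0.
have y3 : y e3 = 0 by apply: (supp_out yz); rewrite suppE z3 eqxx.
have yE e : y e = z e.
  rewrite (aE y by0 e) y1 zE; have := aE y by0 e3; rewrite y3 y1 epsE => /esym/eqP.
  rewrite mul1r -mulrDl mulf_eq0 (negbTE a23) orbF => /eqP E.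
  have -> : y e2 = - eps by lra.
  by rewrite mul1r mulNr.
have signE e : e \in both a1 a2 -> a1 e = eps * a2 e.
  rewrite bothE => /andP[a1e a2e]; have [v1 v2] := basis_unit e.
  by apply: sign_eq; rewrite // -zE -yE.
exists eps; split=> //.
have -> : only1 a1 a2 :|: only1 a2 a1 = supp y; last by [].
apply/setP => e; rewrite in_setU !only1E suppE yE zE.
have [a1e|a1e] := eqVneq (a1 e) 0; have [a2e|a2e] := eqVneq (a2 e) 0 => /=.
- by rewrite a1e a2e mulr0 subrr eqxx.
- rewrite a1e sub0r oppr_eq0 mulf_eq0 (negbTE a2e) orbF.
  by case: eps1 => ->; rewrite ?oppr_eq0 oner_eq0.
- by rewrite a2e mulr0 subr0 a1e.
- by rewrite signE ?subrr ?eqxx// bothE a1e.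
Qed.

Lemma parallel_basis3 e3 : e3 \in both a1 a2 -> parallel e3 = both a1 a2.
Proof.
move=> e3b; have [eps [eps1 epsE _]] := basis_sign e3b.
case: (ba) => -[b1 b2] _ _ _ aE; apply/setP => g; rewrite bothE.
have eps0 : eps != 0 by case: eps1 => ->; rewrite ?oppr_eq0 oner_eq0.
apply/parallelP/andP => [[gc gp]|/andP].
  have := gp (a1 - eps *: a2); rewrite linearB linearZ /= b1 b2 scaler0 subr0.
  rewrite !ffunE -[eps *: a2 e3]epsE// subrr => /(_ erefl erefl)/eqP.
  rewrite subr_eq0 => /eqP a1g; move: gc; rewrite cyclic_basis a1g.
  by rewrite [_ *: _ == 0]mulf_eq0 (negbTE eps0) /= orbb.
rewrite -bothE => gb; split; first by move: gb; rewrite cyclic_basis bothE => /andP[->].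
move=> x bx; rewrite (aE x bx e3) (aE x bx g) !epsE// !mulrA -!mulrDl.
move/eqP; move: e3b; rewrite mulf_eq0 bothE => /andP[_ /negbTE->].
by rewrite orbF => /eqP->; rewrite mul0r.
Qed.

(** In the theta graph the three segments have a common end. *)
Lemma common_vertex e3 : e3 \in both a1 a2 -> exists v,
  [/\ v \in verts (only1 a1 a2), v \in verts (only1 a2 a1)
    & v \in verts (both a1 a2)].
Proof.
move=> e3b; have [_ [_ _ c12]] := basis_sign e3b.
case: (ba) => _ [a11 a12] [a21 a22] [c1 c2] _.
have dis S T : S :&: T = set0 -> [disjoint S & T].
  by move=> ST; rewrite -setI_eq0 ST.
have s1 : supp a1 = only1 a1 a2 :|: both a1 a2.
  by apply/setP => e; rewrite in_setU only1E bothE suppE -andb_orr orbN andbT.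
have s2 : supp a2 = only1 a2 a1 :|: both a1 a2.
  by apply/setP => e; rewrite in_setU only1E bothE suppE [X in _ || X]andbC -andb_orr orbN andbT.
have d13 : [disjoint only1 a1 a2 & both a1 a2].
  apply: dis; apply/setP => e; rewrite in_setI only1E bothE in_set0.
  by case: (a2 e == 0); rewrite ?andbF.
have d23 : [disjoint only1 a2 a1 & both a1 a2].
  apply: dis; apply/setP => e; rewrite in_setI only1E bothE in_set0.
  by case: (a1 e == 0); rewrite ?andbF.
have d12 : [disjoint only1 a1 a2 & only1 a2 a1].
  apply: dis; apply/setP => e; rewrite in_setI !only1E in_set0.
  by case: (a1 e == 0); rewrite ?andbF.
have [v v1 v3] : exists2 v, v \in verts (only1 a1 a2) & v \in verts (both a1 a2).
  apply: contrapT => nv.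
  have e3s : e3 \in supp a1 by rewrite s1 in_setU e3b orbT.
  have e1s : e1 \in supp a1 by rewrite suppE a11 oner_eq0.
  have : e3 \in only1 a1 a2.
    apply: (@connect_joined_ind _ _ _ (fun g => g \in only1 a1 a2) _ _ _
      (cycle_connect c1 e1s e3s)); last by rewrite only1E a11 a21 oner_eq0 eqxx.
    move=> g h /joinedP[v [_ hs _ gv hv]] g1; move: hs; rewrite s1 in_setU.
    by move=> /orP[//|hb]; case: nv; exists v; apply/vertsP; [exists g|exists h].
  by move: e3b; rewrite only1E bothE => /andP[_ /negbTE->]; rewrite andbF.
(* If the second class missed [v], the first and the third would have valence 2
   there, and the cycle they form would have valence 4. *)
exists v; split=> //; apply/negPn; rewrite -valence_eq0; apply/negP => /eqP v2.
have vv1 : v \in verts (supp a1) by apply: (subsetP (vertsS _)) v1; rewrite s1 subsetUl.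
have vv2 : v \in verts (supp a2) by apply: (subsetP (vertsS _)) v3; rewrite s2 subsetUr.
have vv3 : v \in verts (only1 a1 a2 :|: only1 a2 a1).
  by apply: (subsetP (vertsS _)) v1; rewrite subsetUl.
have := cycle_valence c1 vv1; have := cycle_valence c2 vv2.
have := cycle_valence c12 vv3; rewrite s1 s2 !valenceD// v2 addn0 add0n.
by move=> -> ->.
Qed.

End Basis.
End GenusTwo.

(** * Superabundance as a bilinear condition *)

(** A system of equations has full column rank iff it has no nonzero solution. *)
Lemma rank_lt_kernelP (F : fieldType) (m n : nat) (A : 'M[F]_(m, n)) :
  reflect (exists2 v : 'rV[F]_n, v != 0 & A *m v^T = 0) (\rank A < n)%N.
Proof.
have -> : (\rank A < n)%N = (kermx A^T != 0).
  by rewrite -mxrank_eq0 mxrank_ker mxrank_tr -lt0n subn_gt0.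
apply: (iffP rowV0Pn) => -[v].
  by move=> /sub_kermxP vA v0; exists v => //; apply: trmx_inj; rewrite trmx_mul trmxK vA trmx0.
move=> v0 Av; exists v => //; apply/sub_kermxP.
by apply: trmx_inj; rewrite trmx_mul trmxK Av trmx0.
Qed.

(** Integer equations with a nonzero real solution have a nonzero integer
    solution. *)
Lemma int_kernel (R : numFieldType) (m n : nat) (A : 'M[int]_(m, n)) :
  (exists2 v : 'rV[R]_n, v != 0 & map_mx intr A *m v^T = 0) ->
  exists2 v : 'rV[int]_n, v != 0 & A *m v^T = 0.
Proof.
move=> /rank_lt_kernelP.
have -> : map_mx intr A = map_mx (ratr : rat -> R) (map_mx intr A) :> 'M[R]_(m, n).
  by apply/matrixP => i j; rewrite !mxE ratr_int.
rewrite mxrank_map => /rank_lt_kernelP[v v0 Av].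
pose N := \prod_k denq (v 0 k).
pose w : 'rV[int]_n := \row_j (numq (v 0 j) * \prod_(k | k != j) denq (v 0 k)).
have N0 : N != 0 by apply/prodf_neq0 => k _; rewrite denq_neq0.
have wE : map_mx intr w = N%:~R *: v.
  apply/rowP => j; rewrite !mxE /N [in RHS](bigD1 j) //= !rmorphM /=.
  by rewrite mulrAC -[X in _ = X * _]mulrC -numqE.
have inj (p q : nat) : injective (map_mx intr : 'M[int]_(p, q) -> 'M[rat]_(p, q)).
  move=> B C /matrixP BC; apply/matrixP => i j; have := BC i j; rewrite !mxE.
  exact: intr_inj.
exists w.
  apply: contraNneq v0 => w0; have := wE; rewrite w0 map_mx0 => /esym/eqP.
  by rewrite scaler_eq0 intr_eq0 (negbTE N0).
by apply: inj; rewrite map_mxM /= -map_trmx wE linearZ /= -scalemxAr Av scaler0 map_mx0.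
Qed.

(** The positive vectors of a subspace containing at least one of them span
    it. *)
Lemma has_dim_positive (R : realType) (E : finType)
    (W : {vspace {ffun E -> R^o}}) (l : {ffun E -> R^o}) :
  l \in W -> (forall e, 0 < l e) ->
  has_dim (fun x : {ffun E -> R^o} => (forall e, 0 < x e) /\ x \in W) (\dim W).
Proof.
move=> lW l0; pose b := vbasis W; pose c i := coord b i l.
pose s := \sum_i c i.
(* For [t] large the vectors [b_i + t l] are positive; they are dependent only
   if [t = - 1 / s]. *)
pose t : R := 1 + \sum_(i < \dim W) \sum_(e : E) `|b`_i e| / l e + `|s|^-1.
have t_ge0 : 0 <= \sum_(i < \dim W) \sum_(e : E) `|b`_i e| / l e.
  by do 2![apply: sumr_ge0 => ? _]; rewrite divr_ge0// ltW.
pose X := [tuple b`_i + t *: l | i < \dim W].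
have XE (i : 'I_(\dim W)) : X`_i = b`_i + t *: l by rewrite -tnth_nth tnth_mktuple.
have bW (i : 'I_(\dim W)) : b`_i \in W by apply: vbasis_mem; rewrite mem_nth// size_tuple.
have XW x : x \in tval X -> x \in W.
  by move=> /tnthP[i ->]; rewrite (tnth_nth 0) XE rpredD// rpredZ.
have lE : l = \sum_i c i *: b`_i by rewrite -coord_vbasis.
have st : 1 + t * s != 0.
  have [->|s0] := eqVneq s 0; first by rewrite mulr0 addr0 oner_eq0.
  apply: contra_eq_neq (erefl `|t * s|) => /eqP; rewrite addrC addr_eq0 => /eqP ts.
  rewrite {1}ts normrN1 normrM lt_eqF//.
  rewrite ger0_norm ?addr_ge0 ?invr_ge0// -subr_gt0.
  rewrite mulrDl mulVf ?normr_eq0// addrK.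
  by rewrite mulr_gt0 ?normr_gt0// ltr_pwDl.
have lX : l \in <<X>>%VS.
  have : (1 + t * s) *: l = \sum_i c i *: X`_i.
    rewrite scalerDl scale1r mulrC -scalerA {1}lE /s scaler_suml -big_split /=.
    by apply: eq_bigr => i _; rewrite XE scalerDr.
  move=> /(canRL (scalerK st)) ->; rewrite rpredZ// rpred_sum// => i _.
  by rewrite rpredZ// memv_span// mem_nth// size_tuple.
have bX : (<<b>> <= <<X>>)%VS.
  apply/span_subvP => x /tnthP[i ->].
  rewrite (tnth_nth 0) -/b -[b`_i](addrK (t *: l)) -XE rpredB ?rpredZ//.
  by rewrite memv_span// mem_nth// size_tuple.
have WX : (W <= <<X>>)%VS.
  by apply: subv_trans bX; rewrite (span_basis (vbasisP W)).
have XWs : (<<X>> <= W)%VS by apply/span_subvP.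
exists X; split.
- by rewrite /free size_tuple; apply/eqP/anti_leq; rewrite (dimvS XWs) (dimvS WX).
- move=> x xX; split; last exact: XW.
  move=> e; case/tnthP: xX => i ->; rewrite (tnth_nth 0) XE !ffunE.
  have : `|b`_i e| / l e <= \sum_(i < \dim W) \sum_(e : E) `|b`_i e| / l e.
    rewrite (bigD1 i) //= (bigD1 e) //= -addrA lerDl addr_ge0//.
      by apply: sumr_ge0 => ? _; rewrite divr_ge0// ltW.
    by do 2![apply: sumr_ge0 => ? _]; rewrite divr_ge0// ltW.
  rewrite ler_pdivrMr// => bl.
  rewrite -ltrBlDl sub0r (le_lt_trans (ler_norm _))// normrN (le_lt_trans bl)//.
  rewrite [_ *: _]/(t * l e) ltr_pM2r// /t addrAC ltrDr.
  by rewrite ltr_pwDl// invr_ge0.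
- by move=> y [_ yW]; apply: subvP yW.
Qed.

Section Superabundance.
Variables (R : realType) (n : nat) (G : graph) (Gam : tcurve R n G) (r : nat).
Variable phi : param_map Gam r.
Implicit Types (e : edge G) (v : vert G).

Local Notation intmx := (map_mx (intr : int -> R)).

Lemma slope_displacement e :
  len Gam e *: intmx (slope phi e) =
  phi (VertexPt (tgt e)) - phi (VertexPt (src e)).
Proof.
rewrite -map_tgt -map_src (@map_edge _ _ _ _ _ phi e (len Gam e)).
  by rewrite addrC addKr.
by rewrite lexx ltW// len_gt0.
Qed.

(** The displacements along a cycle of the curve add up to zero. *)
Lemma cycle_closes (a : {ffun edge G -> int^o}) : boundary a = 0 ->
  \sum_e ((a e)%:~R * len Gam e) *: intmx (slope phi e) = 0 :> 'cV[R]_r.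
Proof.
move=> ba; under eq_bigr do rewrite -scalerA slope_displacement scalerBr.
pose P v := phi (VertexPt v).
have E (h : edge G -> vert G) : \sum_e (a e)%:~R *: P (h e) =
    \sum_v (\sum_(e | h e == v) a e)%:~R *: P v.
  under [RHS]eq_bigr do rewrite rmorph_sum /= scaler_suml.
  rewrite (exchange_big_dep predT) //=; apply: eq_bigr => e _.
  by rewrite (eq_bigl (pred1 (h e))) ?big_pred1_eq// => v /=; rewrite eq_sym.
rewrite sumrB (E (@tgt G)) (E (@src G)) -sumrB big1 // => v _.
rewrite -scalerBl -rmorphB /=.
by have /ffunP/(_ v) := ba; rewrite !ffunE => ->; rewrite scale0r.
Qed.

Variables (g : nat) (u : edge G -> 'rV[int]_g).
Hypothesis genus_g : genus G = g.
(** The columns of the family [u] generate [H_1(G; Z)]. *)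
Hypothesis u_cycle : forall i, boundary [ffun e => u e 0 i : int^o] = 0.
Hypothesis u_gen : forall a : {ffun edge G -> int^o}, boundary a = 0 ->
  exists k : 'I_g -> int, forall e, a e = \sum_i k i * u e 0 i.

(** The conditions cutting out the deformation cone, for the cycles [u]. *)
Definition closing (l : {ffun edge G -> R^o}) : 'M[R]_(g, r) :=
  \sum_e l e *: ((intmx (u e))^T *m (intmx (slope phi e))^T).

Fact closing_is_linear : linear closing.
Proof.
move=> k x y; rewrite /closing scaler_sumr -big_split /=; apply: eq_bigr => e _.
by rewrite !ffunE scalerDl scalerA.
Qed.
HB.instance Definition _ := GRing.isLinear.Build R
  {ffun edge G -> R^o} 'M[R]_(g, r) *:%R closing closing_is_linear.

Lemma closingE l i j : closing l i j =
  \sum_e (u e 0 i)%:~R * l e * (slope phi e j 0)%:~R.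
Proof.
rewrite /closing summxE; apply: eq_bigr => e _.
by rewrite !mxE big_ord1 !mxE mulrCA mulrA.
Qed.

Lemma deformation_coneE l : deformation_cone phi l <->
  (forall e, 0 < l e) /\ l \in lker (linfun closing).
Proof.
rewrite memv_ker lfunE /=; split=> -[l0 cl]; split=> //.
  apply/eqP/matrixP => i j; rewrite closingE mxE.
  have /matrixP/(_ j 0) := cl _ (u_cycle i); rewrite summxE mxE => E0.
  by apply: etrans E0; apply: eq_bigr => e _; rewrite !mxE !ffunE.
move=> a /u_gen[k aE]; apply/matrixP => j j0; rewrite ord1 summxE [RHS]mxE.
rewrite (eq_bigr (fun e => \sum_i (k i)%:~R *
    ((u e 0 i)%:~R * l e * (slope phi e j 0)%:~R))).
  rewrite exchange_big big1 //= => i _.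
  by rewrite -mulr_sumr -closingE (eqP cl) mxE mulr0.
move=> e _; rewrite !mxE aE rmorph_sum /= !mulr_suml; apply: eq_bigr => i _.
by rewrite intrM !mulrA.
Qed.

Lemma dim_deformation : has_dim (deformation_cone phi) (\dim (lker (linfun closing))).
Proof.
have -> : deformation_cone phi =
    (fun l => (forall e, 0 < l e) /\ l \in lker (linfun closing)).
  by apply/funext => l; apply/propext; apply: deformation_coneE.
have /deformation_coneE[l0 lW] : deformation_cone phi [ffun e => len Gam e].
  split=> [e|a ba]; first by rewrite ffunE len_gt0.
  by under eq_bigr do rewrite ffunE; apply: cycle_closes.
exact: has_dim_positive lW l0.
Qed.

(** Superabundance means that the closing conditions are linearly dependent;
    a dependency is a matrix [L] with [u_e L w_e = 0] on every edge. *)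
Lemma superabundantP : superabundant phi <->
  exists2 L : 'M[R]_(g, r), L != 0 &
    forall e, intmx (u e) *m L *m intmx (slope phi e) = 0.
Proof.
have dimE : (\dim (lker (linfun closing)) + \dim (limg (linfun closing)))%N = #|edge G|.
  have := limg_ker_dim (linfun closing) fullv; rewrite capfv => ->.
  by rewrite dimvf /dim /= muln1.
have dimM : \dim (fullv : {vspace 'M[R]_(g, r)}) = (g * r)%N by rewrite dimvf.
have imE l e : l = [ffun f => (f == e)%:R : R^o] ->
    closing l = (intmx (u e))^T *m (intmx (slope phi e))^T.
  move=> ->; rewrite /closing (bigD1 e) //= ffunE eqxx scale1r big1 ?addr0// => f fe.
  by rewrite ffunE (negbTE fe) scale0r.
rewrite /superabundant genus_g; split.
  move=> [d [[X [freeX X_C _]] dlt]].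
  pose A := \matrix_(k < #|edge G|) mxvec
    ((intmx (u (enum_val k)))^T *m (intmx (slope phi (enum_val k)))^T).
  have [/rank_lt_kernelP[v v0 Av]|] := boolP (\rank A < g * r)%N.
    exists (vec_mx v); first by apply: contraNneq v0 => v0; rewrite -[v]vec_mxK v0 linear0.
    move=> e; have /row_matrixP/(_ (enum_rank e)) := Av.
    rewrite row_mul rowK row0 enum_rankK -[v]vec_mxK vec_mxK.
    by rewrite -{1}[v]vec_mxK mxvec_dotmul trmxK.
  rewrite -leqNgt => rA.
  have fullA : row_full A by rewrite /row_full eqn_leq rank_leq_col.
  have /eqP im_full : limg (linfun closing) == fullv.
    rewrite eqEsubv subvf; apply/subvP => M _.
    have /row_fullP[B BA] := fullA.
    have := congr1 (mulmx (mxvec M)) BA; rewrite mulmx1 mulmxA mulmx_sum_row.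
    move=> /(congr1 vec_mx); rewrite mxvecK linear_sum /= => <-.
    rewrite rpred_sum// => k _; rewrite linearZ /= rpredZ// rowK mxvecK.
    rewrite -(imE _ (enum_val k) erefl) -[closing _](lfunE closing).
    by apply: memv_img; rewrite memvf.
  have : (d <= \dim (lker (linfun closing)))%N.
    rewrite -(size_tuple X) -(eqP freeX); apply/dimvS/span_subvP => x /X_C.
    by move=> /deformation_coneE[].
  move: dimE dlt; rewrite im_full dimM; lia.
move=> [L L0 uLw]; exists (\dim (lker (linfun closing))); split.
  exact: dim_deformation.
have : (\dim (limg (linfun closing)) < g * r)%N.
  rewrite -dimM ltnNge; apply: contraNN L0 => le_dim.
  have /eqP im_full : limg (linfun closing) == fullv by rewrite eqEdim subvf.
  have kill M : mxvec M *m (mxvec L)^T = 0.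
    have /memv_imgP[l _ ->] : M \in limg (linfun closing) by rewrite im_full memvf.
    rewrite lfunE /= linear_sum mulmx_suml big1 // => e _.
    by rewrite linearZ /= -scalemxAl mxvec_dotmul trmxK uLw scaler0.
  apply/eqP/matrixP => i j; have /matrixP/(_ 0 0) := kill (delta_mx i j).
  by rewrite mxvec_delta -rowE !mxE mxvecE.
by move: dimE; lia.
Qed.

End Superabundance.

(** * The two geometric conditions *)

Lemma sum_I2 (V : nmodType) (F : 'I_2 -> V) : \sum_i F i = F 0 + F 1.
Proof.
by rewrite !big_ord_recl big_ord0 addr0; congr (_ + F _); apply: val_inj.
Qed.

Lemma mul_row2 (K : comNzRingType) (n : nat) (a : 'rV[K]_2) (A : 'M[K]_(2, n)) :
  a *m A = a 0 0 *: row 0 A + a 0 1 *: row 1 A.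
Proof. by rewrite mulmx_sum_row sum_I2. Qed.

Lemma I2P (i : 'I_2) : i = 0 \/ i = 1.
Proof. by case: i => [[|[|//]] lt]; [left|right]; apply: val_inj. Qed.

Section Geometry.
Variables (R : realType) (n : nat) (G : graph) (Gam : tcurve R n G).
Implicit Types (S : {set edge G}) (e f g h : edge G) (v : vert G).

Local Notation intmx := (map_mx (intr : int -> R)).

Section Constant.
Variables (r : nat) (phi : param_map Gam r) (mu : 'rV[R]_r).

Lemma const_edge e t : mu *m intmx (slope phi e) = 0 -> 0 <= t <= len Gam e ->
  mu *m phi (EdgePt e t) = mu *m phi (VertexPt (src e)).
Proof.
move=> mw te; rewrite (@map_edge _ _ _ _ _ phi e t te) map_src mulmxDr.
by rewrite -scalemxAr mw scaler0 addr0.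
Qed.

(** A linear form killing all slopes on a connected set of edges is constant
    on its image. *)
Lemma const_connected (C S : {set edge G}) (W : {set vert G}) f v0 :
  f \in S -> (forall g, g \in S -> connect (joined C W) f g) ->
  (forall g h, joined C W g h -> g \in S -> h \in S) ->
  (forall e, e \in S -> mu *m intmx (slope phi e) = 0) ->
  v0 \in verts S ->
  forall p, points_over Gam S p -> mu *m phi p = mu *m phi (VertexPt v0).
Proof.
move=> fS conn clS muS v0S.
pose P c g := g \in S /\ forall v, incident v g -> mu *m phi (VertexPt v) = c.
have P_edge g v : g \in S -> incident v g -> P (mu *m phi (VertexPt v)) g.
  move=> gS vg; split=> // w wg.
  have tgtE : mu *m phi (VertexPt (tgt g)) = mu *m phi (VertexPt (src g)).
    rewrite -map_tgt; apply: const_edge; first exact: muS.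
    by rewrite lexx ltW// len_gt0.
  by case/orP: vg => /eqP <-; case/orP: wg => /eqP <-; rewrite ?tgtE.
have Pall g : g \in S -> P (mu *m phi (VertexPt (src f))) g.
  move=> /conn fg.
  apply: (@connect_joined_ind _ _ _ _ f g _ fg); last exact: P_edge (incident_src f).
  move=> h k hk [hS hc]; have kS := clS _ _ hk hS.
  case/joinedP: hk => v [_ _ _ hv kv]; rewrite -(hc v hv); exact: P_edge.
move=> p [e [t [eS te ->]]]; rewrite const_edge// ?muS//.
have [_ ->] := Pall e eS; last exact: incident_src.
by have /vertsP[g gS gv] := v0S; have [_ ->] := Pall g gS.
Qed.

End Constant.

(** A cycle lies in a line iff some linear form kills its slopes. *)
Lemma planar_superabundantP (phi : param_map Gam 2) :
  planar_superabundant phi <-> exists C : {set edge G}, is_cycle C /\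
    exists2 mu : 'rV[R]_2, mu != 0 &
      forall e, e \in C -> mu *m intmx (slope phi e) = 0.
Proof.
split=> -[C [cC]].
  move=> [p [v [v0 sub]]]; exists C; split=> //.
  pose mu : 'rV[R]_2 := \row_j (if j == 0 then v 1 0 else - v 0 0).
  exists mu.
    apply: contraNneq v0 => /rowP mu0; apply/eqP/matrixP => i j.
    rewrite ord1 mxE; have [->|->] := I2P i.
      by have := mu0 1; rewrite !mxE /= => /eqP; rewrite oppr_eq0 => /eqP.
    by have := mu0 0; rewrite !mxE /=.
  have muv : mu *m v = 0.
    by apply/matrixP => i j; rewrite !ord1 mxE sum_I2 !mxE /=; ring.
  move=> e eC; have lt0 := len_gt0 Gam e.
  have [t0 e0] : affine_line p v (phi (EdgePt e 0)).
    by apply: sub; exists (EdgePt e 0) => //; exists e, 0; rewrite lexx ltW.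
  have [t1 e1] : affine_line p v (phi (EdgePt e (len Gam e))).
    by apply: sub; exists (EdgePt e (len Gam e)) => //; exists e, (len Gam e); rewrite lexx ltW.
  have E : len Gam e *: intmx (slope phi e) = (t1 - t0) *: v.
    by rewrite slope_displacement -map_tgt -map_src e0 e1 scalerBl opprD addrACA subrr add0r.
  apply/eqP; move/(congr1 (mulmx mu)): E; rewrite -!scalemxAr muv scaler0 => /eqP.
  by rewrite scaler_eq0 gt_eqF.
move=> [mu mu0 muC]; have [f fC] := cycle_neq0 cC; exists C; split=> //.
exists (phi (VertexPt (src f))).
exists (\col_i (if i == 0 then - mu 0 1 else mu 0 0)); split.
  apply: contraNneq mu0 => /matrixP mu0; apply/eqP/rowP => j; rewrite mxE.
  have [->|->] := I2P j; first by have := mu0 1 0; rewrite !mxE /=.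
  by have := mu0 0 0; rewrite !mxE /= => /eqP; rewrite oppr_eq0 => /eqP.
move=> _ [p pC <-].
have fv : src f \in verts C by apply/vertsP; exists f; rewrite ?incident_src.
have clC g h : joined C setT g h -> g \in C -> h \in C by move=> /joinedP[? []].
have := const_connected fC (fun g gC => cycle_connect cC fC gC) clC muC fv pC.
set q := phi (VertexPt _) => /matrixP/(_ 0 0).
rewrite !mxE !sum_I2 => E.
(* The parameter is the scalar product with the direction of the line, divided by
   the square of its norm. *)
pose N := mu 0 0 ^+ 2 + mu 0 1 ^+ 2.
have N0 : N != 0.
  apply: contraNneq mu0 => /eqP; rewrite paddr_eq0 ?sqr_ge0// !sqrf_eq0.
  move=> /andP[/eqP m0 /eqP m1]; apply/eqP/rowP => j; rewrite mxE.
  by have [->|->] := I2P j.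
exists ((mu 0 0 * (phi p 1 0 - q 1 0) - mu 0 1 * (phi p 0 0 - q 0 0)) / N).
apply/matrixP => i j; rewrite ord1 !mxE; apply: (mulIf N0).
rewrite mulrDl mulrAC divfK// /N; have [->|->] := I2P i => /=.
  have E1 : mu 0 1 * (phi p 1 0 - q 1 0) = - mu 0 0 * (phi p 0 0 - q 0 0) by lra.
  rewrite mulrBl.
  transitivity (q 0 0 * (mu 0 0 ^+ 2 + mu 0 1 ^+ 2)
     - mu 0 0 * (mu 0 1 * (phi p 1 0 - q 1 0))
     + mu 0 1 ^+ 2 * (phi p 0 0 - q 0 0)); last by ring.
  by rewrite E1; ring.
have E0 : mu 0 0 * (phi p 0 0 - q 0 0) = - mu 0 1 * (phi p 1 0 - q 1 0) by lra.
transitivity (q 1 0 * (mu 0 0 ^+ 2 + mu 0 1 ^+ 2)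
     + mu 0 0 ^+ 2 * (phi p 1 0 - q 1 0)
     - mu 0 1 * (mu 0 0 * (phi p 0 0 - q 0 0))); last by ring.
by rewrite E0; ring.
Qed.

(** An affine map with regular integral linear part keeps the slopes integral,
    so that no dilation is needed after it. *)
Lemma transforms_integral (phi : param_map Gam 2) (Q : 'M[int]_2)
    (b : 'cV[R]_2) : \det Q != 0 ->
  exists phi' : param_map Gam 2, transforms_to phi phi' /\
    forall p, phi' p = intmx Q *m phi p + b.
Proof.
move=> Q0; unshelve eexists.
  apply: (@ParamMap _ _ _ _ _ (fun p => intmx Q *m phi p + b)
    (fun e => Q *m slope phi e) (fun i => Q *m leg_slope phi i)).
  - by move=> e; rewrite map_src.
  - by move=> e; rewrite map_tgt.
  - by move=> i; rewrite map_leg0.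
  - move=> e t te; rewrite (@map_edge _ _ _ _ _ phi e t te) mulmxDr map_mxM.
    by rewrite -scalemxAr addrAC.
  - move=> i t ti; rewrite (@map_leg _ _ _ _ _ phi i t ti) mulmxDr map_mxM.
    by rewrite -scalemxAr addrAC.
  - move=> v; rewrite -!mulmx_sumr -mulmxBr -mulmxDr.
    by have -> := map_balanced phi v; rewrite mulmx0.
split=> //; exists (map_mx intr Q), b; split.
  by rewrite unitmxE unitfE det_map_mx intr_eq0.
exists (fun=> 1), (fun=> 1); split.
  by split=> // e; rewrite rmorph1 mul1r.
have QE : map_mx ratr (map_mx intr Q) = intmx Q.
  by apply/matrixP => i j; rewrite !mxE ratr_int.
by rewrite QE => -[v|e t|i t] _ /=; rewrite ?rmorph1 ?mul1r.
Qed.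

(** If the transformed edge lies in the kernel of a linear form, the slope of
    the original edge is killed by the pulled-back form. *)
Lemma transforms_slope (phi : param_map Gam 2) (Gam' : tcurve R n G)
    (phi' : param_map Gam' 2) : transforms_to phi phi' ->
  exists2 Q : 'M[R]_2, Q \in unitmx & forall (nu : 'rV[R]_2) S,
    (forall p, points_over Gam' S p -> nu *m phi' p = 0) ->
    forall e, e \in S -> nu *m Q *m intmx (slope phi e) = 0.
Proof.
move=> [Q [b [Qu [c [d [[c0 _ _ lenE] phiE]]]]]].
exists (map_mx ratr Q); first by rewrite map_unitmx.
move=> nu S nuS e eS; have lt0 := len_gt0 Gam e.
have E t : 0 <= t <= len Gam e ->
    nu *m (map_mx ratr Q *m phi (EdgePt e t) + b) = 0.
  move=> te; rewrite -phiE//=; apply: nuS; exists e, (ratr (c e) * t); split=> //.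
  have ce : 0 < ratr (c e) :> R by rewrite ltr0q.
  by case/andP: te => t0 tl; rewrite lenE mulr_ge0 ?ler_pM2l// ltW.
have {}E : nu *m map_mx ratr Q *m (len Gam e *: intmx (slope phi e)) = 0.
  rewrite slope_displacement -map_tgt -map_src.
  rewrite -[RHS](subrr (0 : 'M_1)) -{1}(E (len Gam e)) ?lexx ?ltW// -(E 0) ?lexx ?ltW//.
  by rewrite -mulmxBr opprD addrACA subrr addr0 -mulmxBr mulmxA.
by move/eqP: E; rewrite -scalemxAr scaler_eq0 gt_eqF//= => /eqP.
Qed.

End Geometry.

(** * The classification *)

Section Classification.
Variable G : graph.
Implicit Types (e f : edge G) (a : {ffun edge G -> rat^o}).

(** The basis [a1], [a2] of [H_1] read as a vector of integers on each edge. *)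
Definition integral_form a1 a2 (u : edge G -> 'rV[int]_2) : Prop :=
  forall e, a1 e = (u e 0 0)%:~R /\ a2 e = (u e 0 1)%:~R.

Lemma exists_integral_form e1 e2 a1 a2 : cycle_basis e1 e2 a1 a2 ->
  exists u, integral_form a1 a2 u.
Proof.
move=> ba; exists (fun e => \row_j (if j == 0 then numq (a1 e) else numq (a2 e))).
by move=> e; rewrite !mxE /=; have [] := basis_unit ba e;
  move=> [->|[->|->]] [->|[->|->]].
Qed.

Lemma boundary_intr (b : {ffun edge G -> int^o}) a :
  (forall e, a e = (b e)%:~R) -> forall v, boundary a v = (boundary b v)%:~R.
Proof.
move=> ab v; rewrite !ffunE rmorphB !rmorph_sum /=.
by congr (_ - _); apply: eq_bigr => e _; rewrite ab.
Qed.

Lemma integral_form_cycle e1 e2 a1 a2 u : cycle_basis e1 e2 a1 a2 ->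
  integral_form a1 a2 u -> forall i, boundary [ffun e => u e 0 i : int^o] = 0.
Proof.
move=> [[b1 b2] _ _ _ _] au i; apply/ffunP => v; apply: (@intr_inj rat).
rewrite [in RHS]ffunE.
have [->|->] := I2P i.
  rewrite -(@boundary_intr _ a1); first by rewrite b1 ffunE.
  by move=> e; rewrite ffunE; have [] := au e.
rewrite -(@boundary_intr _ a2); first by rewrite b2 ffunE.
by move=> e; rewrite ffunE; have [] := au e.
Qed.

Lemma integral_form_gen e1 e2 a1 a2 u : cycle_basis e1 e2 a1 a2 ->
  integral_form a1 a2 u -> forall b : {ffun edge G -> int^o}, boundary b = 0 ->
  exists k : 'I_2 -> int, forall e, b e = \sum_i k i * u e 0 i.
Proof.
move=> [_ _ _ _ aE] au b bb; exists (fun i => if i == 0 then b e1 else b e2) => e.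
pose x : {ffun edge G -> rat^o} := [ffun e => (b e)%:~R].
have xE f : x f = (b f)%:~R by rewrite ffunE.
have bx : boundary x = 0.
  by apply/ffunP => v; rewrite (boundary_intr xE) bb !ffunE.
apply: (@intr_inj rat); rewrite sum_I2 /= rmorphD !rmorphM /= -!xE.
by have [<- <-] := au e; rewrite (aE x bx e) !ffunE.
Qed.

End Classification.

Lemma scalemx_eq0 (K : idomainType) (m n : nat) (k : K) (A : 'M[K]_(m, n)) :
  k != 0 -> k *: A = 0 -> A = 0.
Proof.
move=> k0 /matrixP kA; apply/matrixP => i j; have /eqP := kA i j.
by rewrite !mxE mulf_eq0 (negbTE k0) => /eqP.
Qed.

Lemma det2 (K : comNzRingType) (A : 'M[K]_2) :
  \det A = A 0 0 * A 1 1 - A 0 1 * A 1 0.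
Proof.
rewrite (expand_det_row _ 0) sum_I2 /cofactor !det_mx11 !mxE /=.
rewrite expr0 mul1r expr1 mulN1r mulrN.
by congr (_ * A _ _ - _ * A _ _); apply: val_inj.
Qed.

(** A nonzero singular matrix of order 2 is, up to a factor, a column times a
    row. *)
Lemma singular_rank1 (L : 'M[int]_2) : L != 0 -> \det L = 0 ->
  exists s mu : 'rV[int]_2, [/\ s != 0, mu != 0 &
    exists2 k : int, k != 0 & k *: L = s^T *m mu].
Proof.
move=> L0; rewrite det2 => /eqP; rewrite subr_eq0 => /eqP d0.
have nz (m : 'rV[int]_2) j : m 0 j != 0 -> m != 0.
  by apply: contraNneq => ->; rewrite mxE.
have [i [j Lij]] : exists i j, L i j != 0.
  apply: contrapT => nL; case/eqP: L0; apply/matrixP => i j; rewrite mxE.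
  by apply/eqP/negPn/negP => Lij; apply: nL; exists i, j.
(* The column through a nonzero entry times the row through it. *)
exists (col j L)^T, (row i L); split.
- by apply: (@nz _ i); rewrite !mxE.
- by apply: (@nz _ j); rewrite mxE.
exists (L i j) => //; apply/matrixP => p q; rewrite !mxE big_ord1 !mxE.
case: (I2P i) => ->; case: (I2P j) => ->; case: (I2P p) => ->;
  case: (I2P q) => -> //; first [exact: mulrC | by rewrite d0 mulrC
  | by rewrite mulrC d0 | by rewrite -d0 mulrC | by rewrite mulrC -d0].
Qed.

Section Superabundant2.
Variables (R : realType) (n : nat) (G : graph) (Gam : tcurve R n G).
Variable phi : param_map Gam 2.
Hypothesis genus2 : genus G = 2%N.
Implicit Types (e f : edge G) (a : {ffun edge G -> rat^o}).

Local Notation intmx := (map_mx (intr : int -> R)).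

Lemma superabundant_basisP e1 e2 a1 a2 u : cycle_basis e1 e2 a1 a2 ->
  integral_form a1 a2 u ->
  superabundant phi <-> exists2 L : 'M[R]_2, L != 0 &
    forall e, intmx (u e) *m L *m intmx (slope phi e) = 0.
Proof.
move=> ba au; apply: superabundantP genus2 _ _.
  exact: integral_form_cycle ba au.
exact: integral_form_gen ba au.
Qed.

Lemma intmx_inj (p q : nat) : injective (intmx : 'M[int]_(p, q) -> 'M[R]_(p, q)).
Proof.
move=> B C /matrixP BC; apply/matrixP => i j; have := BC i j; rewrite !mxE.
exact: intr_inj.
Qed.

Lemma integral_dependency (u : edge G -> 'rV[int]_2) :
  (exists2 L : 'M[R]_2, L != 0 &
    forall e, intmx (u e) *m L *m intmx (slope phi e) = 0) ->
  exists2 L : 'M[int]_2, L != 0 & forall e, u e *m L *m slope phi e = 0.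
Proof.
move=> [L L0 uL].
pose A := \matrix_(k < #|edge G|)
  mxvec ((u (enum_val k))^T *m (slope phi (enum_val k))^T).
have [|v v0 Av] := @int_kernel R _ _ A.
  exists (mxvec L).
    by apply: contraNneq L0 => L0; rewrite -[L]mxvecK L0 linear0.
  apply/row_matrixP => k; rewrite row_mul row0 -map_row rowK map_mxvec map_mxM.
  by rewrite -!map_trmx mxvec_dotmul trmxK uL.
exists (vec_mx v).
  by apply: contraNneq v0 => v0; rewrite -[v]vec_mxK v0 linear0.
move=> e; have /row_matrixP/(_ (enum_rank e)) := Av.
rewrite row_mul rowK row0 enum_rankK -{1}[v]vec_mxK.
by rewrite mxvec_dotmul trmxK.
Qed.

Lemma form2E (u : 'rV[int]_2) (L : 'M[int]_2) (w : 'cV[int]_2) :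
  u *m L *m w = u 0 0 *: (row 0 L *m w) + u 0 1 *: (row 1 L *m w).
Proof. by rewrite (mul_row2 u L) mulmxDl -!scalemxAl. Qed.

Lemma planar_of_form (C : {set edge G}) (mu : 'rV[int]_2) :
  is_cycle C -> mu != 0 -> (forall e, e \in C -> mu *m slope phi e = 0) ->
  planar_superabundant phi.
Proof.
move=> cC mu0 muC; apply/planar_superabundantP; exists C; split=> //.
exists (intmx mu); first by rewrite -(map_mx0 intr) (inj_eq (@intmx_inj _ _)).
by move=> e /muC; rewrite -map_mxM => ->; rewrite map_mx0.
Qed.

Lemma superabundant_classify : superabundant phi -> planar_superabundant phi \/
  exists (Gam' : tcurve R n G) (phi' : param_map Gam' 2),
     transforms_to phi phi' /\ has_three_concurrent_segments phi'.
Proof.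
have [e1 [e2 [a1 [a2 ba]]]] := exists_basis genus2.
have [u au] := exists_integral_form ba.
move=> /(superabundant_basisP ba au)/integral_dependency[L L0 uL].
case: (ba) => -[b1 b2] [a11 a12] [a21 a22] [c1 c2] aE.
have [detL|detL] := eqVneq (\det L) 0.
  left; have [s [mu [s0 mu0 [k k0 kL]]]] := singular_rank1 L0 detL.
  pose x : {ffun edge G -> rat^o} := (s 0 0)%:~R *: a1 + (s 0 1)%:~R *: a2.
  have xE e : x e = ((u e *m s^T) 0 0)%:~R.
    have [a1e a2e] := au e; rewrite !mxE sum_I2 rmorphD !rmorphM /= !mxE -a1e -a2e.
    by rewrite !ffunE mulrC [X in _ + X]mulrC.
  have bx : boundary x = 0 by rewrite linearD !linearZ /= b1 b2 !scaler0 addr0.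
  have [e xe] : exists e, x e != 0.
    apply: contrapT => nx; case/eqP: s0; apply/rowP => j; rewrite mxE.
    have x0 e : x e = 0 by apply/eqP/negPn/negP => xe; apply: nx; exists e.
    have [->|->] := I2P j; apply: (@intr_inj rat).
      by have := x0 e1; rewrite !ffunE a11 a21 scaler0 addr0 [_ *: _]mulr1 => ->.
    by have := x0 e2; rewrite !ffunE a12 a22 scaler0 add0r [_ *: _]mulr1 => ->.
  have [y [_ yx cy _ _]] := cycle_through bx xe.
  apply: planar_of_form cy mu0 _ => f /(subsetP yx); rewrite suppE xE intr_eq0 => xf.
  have := congr1 (fun M => u f *m M *m slope phi f) kL.
  rewrite -scalemxAr -scalemxAl uL scaler0 mulmxA -mulmxA [u f *m _]mx11_scalar.
  by rewrite mul_scalar_mx => /esym; apply: scalemx_eq0.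
have rowL : row 0 L != 0.
  apply: contraNneq detL => /rowP r0; rewrite det2.
  by have := r0 0; have := r0 1; rewrite !mxE => -> ->; rewrite !mul0r subrr.
have onS1 e : e \in only1 a1 a2 -> row 0 L *m slope phi e = 0.
  rewrite only1E; have [-> ->] := au e; rewrite !intr_eq0 => /andP[u0 /eqP u1].
  by have := uL e; rewrite form2E u1 scale0r addr0; apply: scalemx_eq0.
have [b0|[e3 e3b]] := set_0Vmem (both a1 a2).
  left; apply: (planar_of_form c1 rowL) => e; rewrite suppE => a1e; apply: onS1.
  rewrite only1E a1e; apply/negPn/negP => a2e.
  by have := bothE a1 a2 e; rewrite b0 a1e a2e inE.
right.
have onS2 e : e \in only1 a2 a1 -> row 1 L *m slope phi e = 0.
  rewrite only1E; have [-> ->] := au e; rewrite !intr_eq0 => /andP[u1 /eqP u0].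
  by have := uL e; rewrite form2E u0 scale0r add0r; apply: scalemx_eq0.
have [eps [eps1 epsE _]] := basis_sign ba e3b.
have [k k1 epsk] : exists2 k : int, k = 1 \/ k = -1 & eps = k%:~R.
  by case: eps1 => ->; [exists 1|exists (-1)] => //; [left|right].
have k0 : k != 0 by case: k1 => ->.
have onS3 e : e \in both a1 a2 -> (k *: row 0 L + row 1 L) *m slope phi e = 0.
  move=> eb; move: (epsE e eb) (eb); rewrite bothE.
  have [-> ->] := au e; rewrite epsk -rmorphM /= => /intr_inj u0 /andP[_].
  rewrite intr_eq0 => u1; have := uL e.
  rewrite form2E u0 mulrC -scalerA -scalerDr => /(scalemx_eq0 u1).
  by rewrite scalemxAl -mulmxDl.
(* In the coordinates [x = L_0], [y = - k L_1] the third form is [k (x - y)]. *)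
pose Q : 'M[int]_2 := \matrix_(i, j) (if i == 0 then L 0 j else - k * L 1 j).
have detQ : \det Q != 0.
  rewrite det2 !mxE /=.
  have -> : L 0 0 * (- k * L 1 1) - L 0 1 * (- k * L 1 0) = - k * \det L.
    by rewrite det2; ring.
  by rewrite mulf_neq0// oppr_eq0.
have [v [v1 v2 v3]] := common_vertex ba e3b.
have [phi' [tr phi'E]] := transforms_integral phi
  (- (intmx Q *m phi (VertexPt v))) detQ.
have cyc e : e \in supp a1 \/ e \in supp a2 -> e \in cyclic_edges G.
  by rewrite !suppE (cyclic_basis ba) => -[->|->]; rewrite ?orbT.
have [S1 S2 S3] := And3 (parallel_basis1 ba) (parallel_basis2 ba)
  (parallel_basis3 ba e3b).
exists Gam, phi'; split=> //.
exists (only1 a1 a2), (only1 a2 a1), (both a1 a2); split; first split.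
- apply/(segmentsP genus2); exists e1 => //; apply: cyc; left.
  by rewrite suppE a11 oner_eq0.
- apply/(segmentsP genus2); exists e2 => //; apply: cyc; right.
  by rewrite suppE a22 oner_eq0.
- apply/(segmentsP genus2); exists e3 => //; apply: cyc; left.
  by move: e3b; rewrite bothE suppE => /andP[].
- have sep (S T : {set edge G}) e : e \in S -> e \notin T -> S != T.
    by move=> eS; apply: contraNneq => <-.
  rewrite /= !inE !negb_or; apply/and3P; split=> //; last first.
    by apply: (sep _ _ e2); rewrite ?only1E ?bothE a22 a12 ?oner_eq0 ?eqxx.
  by apply/andP; split; apply: (sep _ _ e1);
    rewrite ?only1E ?bothE a11 a21 ?oner_eq0 ?eqxx ?andbF.
have image f (mu : 'rV[int]_2) : f \in cyclic_edges G -> v \in verts (parallel f) ->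
    (forall e, e \in parallel f -> mu *m Q *m slope phi e = 0) ->
    forall p, points_over Gam (parallel f) p -> intmx mu *m phi' p = 0.
  move=> fc vf muS p pS; rewrite phi'E -mulmxBr mulmxA -map_mxM mulmxBr.
  rewrite (@const_connected _ _ _ _ _ phi (intmx (mu *m Q)) (cyclic_edges G)
    (parallel f) [set v | valence (cyclic_edges G) v == 2%N] f v) ?subrr//.
  - by apply/parallelP.
  - by move=> g; rewrite -connect_parallel.
  - move=> g h gh; rewrite -!connect_parallel// => fg.
    exact: connect_trans fg (connect1 gh).
  - by move=> e /muS; rewrite -map_mxM => ->; rewrite map_mx0.
have Q0 : row 0 Q = row 0 L by apply/rowP => j; rewrite !mxE.
have Q1 : row 1 Q = - k *: row 1 L by apply/rowP => j; rewrite !mxE.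
have get (i : 'I_2) p : intmx (delta_mx 0 i : 'rV_2) *m phi' p = row i (phi' p).
  by rewrite map_delta_mx -rowE.
split=> _ [p pS <-] /=.
- have := image e1 (delta_mx 0 0) _ _ _ p; rewrite S1 get.
  move=> /(_ _ v1 _ pS)/matrixP/(_ 0 0); rewrite !mxE; apply.
    by apply: cyc; left; rewrite suppE a11 oner_eq0.
  by move=> e /onS1; rewrite -rowE Q0.
- have := image e2 (delta_mx 0 1) _ _ _ p; rewrite S2 get.
  move=> /(_ _ v2 _ pS)/matrixP/(_ 0 0); rewrite !mxE; apply.
    by apply: cyc; right; rewrite suppE a22 oner_eq0.
  by move=> e /onS2 L1; rewrite -rowE Q1 -scalemxAl L1 scaler0.
- have get3 : intmx (delta_mx 0 0 - delta_mx 0 1 : 'rV_2) *m phi' p =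
      row 0 (phi' p) - row 1 (phi' p) by rewrite map_mxB mulmxBl !get.
  have := image e3 (delta_mx 0 0 - delta_mx 0 1) _ _ _ p; rewrite S3 get3.
  move=> /(_ _ v3 _ pS)/matrixP/(_ 0 0); rewrite !mxE => E.
  apply/eqP; rewrite -subr_eq0; apply/eqP; apply: E.
    by apply: cyc; left; move: e3b; rewrite bothE suppE => /andP[].
  move=> e /onS3 L3; rewrite mulmxBl -!rowE Q0 Q1.
  have -> : row 0 L - (- k) *: row 1 L = k *: (k *: row 0 L + row 1 L).
    rewrite scalerDr scalerA scaleNr opprK; congr (_ + _).
    by case: k1 => ->; rewrite ?mulrNN mulr1 scale1r.
  by rewrite -scalemxAl L3 scaler0.
Qed.

Lemma planar_superabundant_superabundant :
  planar_superabundant phi -> superabundant phi.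
Proof.
move=> /planar_superabundantP[C [cC [mu mu0 muC]]].
have [e1 [e2 [a1 [a2 ba]]]] := exists_basis genus2.
have [u au] := exists_integral_form ba.
have [e eC] := cycle_neq0 cC; have [x [bx xC xe _]] := cycle_chain cC eC.
apply/(superabundant_basisP ba au).
pose s : 'rV[R]_2 := \row_i ratr (if i == 0 then x e1 else x e2).
have us f : intmx (u f) *m s^T = (ratr (x f))%:M.
  case: ba => _ _ _ _ aE; rewrite [LHS]mx11_scalar; congr (_%:M).
  rewrite !mxE sum_I2 !mxE /= (aE x bx f); have [-> ->] := au f.
  by rewrite rmorphD !rmorphM /= !ratr_int mulrC [X in _ + X]mulrC.
exists (s^T *m mu).
  apply: contraNneq mu0 => smu; have := congr1 (mulmx (intmx (u e))) smu.
  by rewrite mulmxA us xe rmorph1 mul1mx mulmx0 => ->.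
move=> f; rewrite mulmxA us mul_scalar_mx -scalemxAl.
have [fC|fC] := boolP (f \in C); first by rewrite muC// scaler0.
have -> : x f = 0 by apply/eqP; rewrite -[_ == _]negbK -suppE xC.
by rewrite rmorph0 scale0r.
Qed.

Lemma concurrent_superabundant (Gam' : tcurve R n G) (phi' : param_map Gam' 2) :
  transforms_to phi phi' -> has_three_concurrent_segments phi' ->
  superabundant phi.
Proof.
move=> /transforms_slope[Q Qu Qs] [T1 [T2 [T3 [[s1 s2 s3 uT] [l1 l2 l3]]]]].
have /segmentsP[//|f1 f1c T1E] := s1; have /segmentsP[//|f2 f2c T2E] := s2.
have /segmentsP[//|f3 f3c T3E] := s3.
have sep f g : f \in cyclic_edges G -> g \in cyclic_edges G ->
    parallel f != parallel g ->
    exists x : {ffun edge G -> rat^o}, [/\ boundary x = 0, x f = 0 & x g != 0].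
  move=> fc gc; have [gf|gf _] := boolP (g \in parallel f).
    by rewrite (parallel_eq genus2 fc gf) eqxx.
  apply: contrapT => nx; case/negP: gf; apply/parallelP; split=> // x bx xf.
  by apply/eqP/negPn/negP => xg; apply: nx; exists x.
move: uT; rewrite T1E T2E T3E /= !inE negb_or andbT => /andP[/andP[n12 n13] n23].
have [x2 [bx2 x21 x22]] := sep _ _ f1c f2c n12.
have [x1 [bx1 x12 x11]] : exists x : {ffun edge G -> rat^o},
    [/\ boundary x = 0, x f2 = 0 & x f1 != 0].
  by apply: sep; rewrite // eq_sym.
have [a1 [a2 ba]] := exists_cycle_basis genus2 bx1 bx2 x11 x12 x21 x22.
have [u au] := exists_integral_form ba.
case: (ba) => _ [a11 a12] [a21 a22] _ aE.
have f3b : f3 \in both a1 a2.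
  have [x [bx x1f x3]] := sep _ _ f1c f3c n13.
  have [y [by0 y2f y3]] := sep _ _ f2c f3c n23.
  rewrite bothE; apply/andP; split.
    by apply: contraNneq y3 => a13; rewrite (aE y by0 f3) a13 y2f mulr0 mul0r addr0.
  by apply: contraNneq x3 => a23; rewrite (aE x bx f3) a23 x1f mulr0 mul0r addr0.
have [eps [eps1 epsE _]] := basis_sign ba f3b.
pose nu1 : 'rV[R]_2 := delta_mx 0 0; pose nu2 : 'rV[R]_2 := delta_mx 0 1.
have nuE p : [/\ nu1 *m p = (p 0 0)%:M & nu2 *m p = (p 1 0)%:M].
  by split; rewrite -rowE [LHS]mx11_scalar mxE.
have k1 e : e \in only1 a1 a2 -> nu1 *m Q *m intmx (slope phi e) = 0.
  rewrite -(parallel_basis1 ba) -T1E; apply: Qs => p pT.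
  have [-> _] := nuE (phi' p); have /= -> : phi' p 0 0 = 0 by apply: l1; exists p.
  by rewrite raddf0.
have k2 e : e \in only1 a2 a1 -> nu2 *m Q *m intmx (slope phi e) = 0.
  rewrite -(parallel_basis2 ba) -T2E; apply: Qs => p pT.
  have [_ ->] := nuE (phi' p); have /= -> : phi' p 1 0 = 0 by apply: l2; exists p.
  by rewrite raddf0.
have k3 e : e \in both a1 a2 ->
    nu1 *m Q *m intmx (slope phi e) = nu2 *m Q *m intmx (slope phi e).
  move=> eb; apply/eqP; rewrite -subr_eq0 -!mulmxBl; apply/eqP; move: e eb.
  rewrite -(parallel_basis3 ba f3b) -T3E; apply: Qs => p pT.
  have [n1 n2] := nuE (phi' p); rewrite mulmxBl n1 n2.
  have /= -> : phi' p 0 0 = phi' p 1 0 by apply: l3; exists p.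
  by rewrite subrr.
(* On the third class [a1 = eps a2], so the two rows cancel there. *)
apply/(superabundant_basisP ba au).
exists (\matrix_i (if i == 0 then nu1 *m Q else - ratr eps *: (nu2 *m Q))).
  apply/eqP => /row_matrixP/(_ 0); rewrite rowK row0 /= => /(canRL (mulmxK Qu)).
  rewrite mul0mx => /rowP/(_ 0); rewrite !mxE !eqxx => /eqP.
  by rewrite oner_eq0.
move=> e; rewrite (mul_row2 (intmx (u e))) !rowK /= mulmxDl -!scalemxAl !mxE.
have := k1 e; have := k2 e; have := k3 e; have := epsE e.
rewrite bothE !only1E; have [a1e a2e] := au e.
rewrite -(ratr_int R (u e 0 0)) -(ratr_int R (u e 0 1)) -a1e -a2e.
have [->|a1n] := eqVneq (a1 e) 0; have [->|a2n] := eqVneq (a2 e) 0 => /=.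
- by rewrite rmorph0 !scale0r addr0.
- by move=> _ _ -> // _; rewrite rmorph0 !(scale0r, scaler0) addr0.
- by move=> _ _ _ -> //; rewrite rmorph0 !(scale0r, scaler0) addr0.
- move=> -> // -> // _ _; rewrite rmorphM /= scalerA -scalerDl.
  by rewrite mulrN [ratr (a2 e) * _]mulrC subrr scale0r.
Qed.

End Superabundant2.

Theorem theoremB (R : realType) (n : nat) (G : graph) (Gam : tcurve R n G)
    (phi : param_map Gam 2) (hgenus : genus G = 2) :
  superabundant phi <->
  (planar_superabundant phi \/
   exists (Gam' : tcurve R n G) (phi' : param_map Gam' 2),
     transforms_to phi phi' /\ has_three_concurrent_segments phi').
Proof.
split; first exact: superabundant_classify.
case=> [|[Gam' [phi' [tr seg]]]]; first exact: planar_superabundant_superabundant.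
exact: concurrent_superabundant tr seg.
Qed.
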